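(* Let $l,m\ge1$ be integers, $l$ even if $G_n=Sp_n$. Let $\lambda$ and $\mu$ be the parameters (partitions) of any irreducible polynomial representations of the groups $G_{n+l}$ and $G_l$ respectively, such that $\lambda'_1\le m$ and $\mu'_1\le m$. Then the action of $\mathrm X(\mathfrak g_n)$ on the vector space $$\operatorname{Hom}_{\mathfrak f_m}\big(L_{\bar\lambda},\,L_{\bar\mu}\otimes\mathcal P(\mathbb C^m\otimes\mathbb C^n)\big)=\operatorname{Hom}_{G_l}(W_\mu,W_\lambda)$$ via the Olshanski homomorphism $\gamma_l$ coincides with the action obtained by pulling the action of $\mathrm X(\mathfrak g_n)$ on the bimodule $\mathcal F_m(L_{\bar\mu})$ back through the automorphism $S_{ij}(u)\mapsto f(u)S_{ij}(u)$ of $\mathrm X(\mathfrak g_n)$, where $$f(u)=1+m\Big(u-\frac{l\mp1}2\Big)^{-1}.$$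
   Context: Conventions. $n\ge1$ is an integer; $G_n$ is one of the complex groups $O_n$, $Sp_n$ ($n$ even if $G_n=Sp_n$). In all double signs the upper sign is for $G_n=O_n$, the lower for $G_n=Sp_n$. For $1\le i\le n$: $\tilde\imath=i-1$ if $i$ is even; $\tilde\imath=i+1$ if $i$ is odd, $i<n$; $\tilde\imath=n$ if $i=n$ is odd. $\theta_i=1$ for $O_n$, $\theta_i=(-1)^{i-1}$ for $Sp_n$. For $n<i\le n+l$: $\tilde\imath=i-1$ if $i-n$ is even; $\tilde\imath=i+1$ if $i-n$ is odd and $i<n+l$; $\tilde\imath=i$ if $i=n+l$ and $l$ is odd; $\theta_i=1$ for $O_n$, $\theta_i=(-1)^{i-n-1}$ for $Sp_n$. Equip $\mathbb C^{n+l}=\mathbb C^n\oplus\mathbb C^l$ (spanned by $e_1,\dots,e_n$ and $e_{n+1},\dots,e_{n+l}$) with the form $\langle e_i,e_j\rangle=\theta_i\delta_{\tilde\imath j}$. $G_n,G_l,G_{n+l}$ are the groups (all of the same type) preserving the form on $\mathbb C^n,\mathbb C^l,\mathbb C^{n+l}$, with $G_n\times G_l\subset G_{n+l}$; $\mathfrak g_n,\mathfrak g_l,\mathfrak g_{n+l}$ are their Lie algebras. $\mathrm X(\mathfrak g_n)$ (extended twisted Yangian) is the unital associative $\mathbb C$-algebra with generators $S_{ij}^{(r)}$ ($r\ge1$, $1\le i,j\le n$), $S_{ij}(u)=\delta_{ij}+\sum_{r\ge1}S_{ij}^{(r)}u^{-r}$, $S(u)=(S_{ij}(u))$, and relations $R(u-v)S_1(u)R'(-u-v)S_2(v)=S_2(v)R'(-u-v)S_1(u)R(u-v)$,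 where $R(u)=u-\sum E_{ij}\otimes E_{ji}$, $R'(u)=u-\sum\theta_i\theta_jE_{ij}\otimes E_{\tilde\imath\tilde\jmath}$, $S_1(u)=S(u)\otimes1$, $S_2(v)=1\otimes S(v)$; $\mathrm X(\mathfrak g_{n+l})$ is defined likewise with indices $1,\dots,n+l$. For any series $f(u)\in1+u^{-1}\mathbb C[[u^{-1}]]$, $S_{ij}(u)\mapsto f(u)S_{ij}(u)$ is an automorphism of $\mathrm X(\mathfrak g_n)$. Olshanski homomorphism. $\omega_n$ is the automorphism $S(u)\mapsto S(-u-\frac n2)^{-1}$ of $\mathrm X(\mathfrak g_n)$ (and $\omega_{n+l}$ similarly, with $n+l$ for $n$); $\iota_l:\mathrm X(\mathfrak g_n)\to\mathrm X(\mathfrak g_{n+l})$ is $S_{ij}^{(r)}\mapsto S_{ij}^{(r)}$ for $1\le i,j\le n$; $\pi_{n+l}:\mathrm X(\mathfrak g_{n+l})\to\mathrm U(\mathfrak g_{n+l})$ is $S_{ij}(u)\mapsto\delta_{ij}+\dfrac{E_{ij}-\theta_i\theta_jE_{\tilde\jmath\tilde\imath}}{u\pm\frac12}$. Then $\gamma_l=\pi_{n+l}\,\omega_{n+l}\,\iota_l\,\omega_n:\mathrm X(\mathfrak g_n)\to\mathrm U(\mathfrak g_{n+l})$; its image lies in the subalgebra $\mathrm C_l\subset\mathrm U(\mathfrak g_{n+l})$ of $G_l$-invariants. $\mathfrak f_m=\mathfrak{sp}_{2m}$ if $G_n=O_n$, $\mathfrak{so}_{2m}$ if $G_n=Sp_n$,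 realized in $\mathfrak{gl}_{2m}$ (indices $-m,\dots,-1,1,\dots,m$) as the span of $F_{ab}=E_{ab}-\varepsilon_{ab}E_{-b,-a}$, with $\varepsilon_{ab}=\operatorname{sign}a\cdot\operatorname{sign}b$ for $\mathfrak{sp}_{2m}$, $\varepsilon_{ab}=1$ for $\mathfrak{so}_{2m}$. $F_{ab}(u)$ is the $a,b$ entry of $(u-F)^{-1}$, $F=(F_{ab})$. The Cartan subalgebra $\mathfrak h$ has basis $F_{-m,-m},\dots,F_{-1,-1}$; a weight $\kappa$ has labels $\kappa_a=\kappa(F_{a-m-1,a-m-1})$, $a=1,\dots,m$; $L_\kappa$ is the simple $\mathfrak f_m$-module with highest weight $\kappa$, the highest vector being annihilated by all $F_{ab}$ with $a<b$. $\mathcal P(\mathbb C^m\otimes\mathbb C^n)$ is the polynomial ring in $x_{ai}$ ($1\le a\le m$, $1\le i\le n$), with partial derivations $\partial_{ai}$; $\mathcal{PD}$ is the corresponding ring of differential operators. $\mathfrak f_m$ acts on $\mathcal P(\mathbb C^m\otimes\mathbb C^n)$ via $\zeta_n$: for $a,b=1,\dots,m$, $F_{ab}\mapsto\delta_{ab}\frac n2+\sum_kx_{ak}\partial_{bk}$, $F_{a,-b}\mapsto-\sum_k\theta_kx_{a\tilde k}x_{bk}$, $F_{-a,b}\mapsto\sum_k\theta_k\partial_{ak}\partial_{b\tilde k}$; similarly on $\mathcal P(\mathbb C^m\otimes\mathbb C^{l})$ and $\mathcal P(\mathbb C^m\otimes\mathbb C^{n+l})$ (sums over $k=n+1,\dots,n+l$,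 respectively $k=1,\dots,n+l$, with $\frac n2$ replaced by $\frac l2$, $\frac{n+l}2$). These actions commute with the natural actions of $G_n,G_l,G_{n+l}$, where $E_{ij}-\theta_i\theta_jE_{\tilde\jmath\tilde\imath}$ acts as $\sum_{c=1}^m(x_{ci}\partial_{cj}-\theta_i\theta_jx_{c\tilde\jmath}\partial_{c\tilde\imath})$. The functor $\mathcal F_m$. For $c<0$ put $p_{ci}=x_{-c,i}$, $q_{ci}=\partial_{-c,i}$; for $c>0$ put $p_{ci}=-\theta_i\partial_{c\tilde\imath}$, $q_{ci}=\theta_ix_{c\tilde\imath}$. The homomorphism $\beta_m:\mathrm X(\mathfrak g_n)\to\mathrm U(\mathfrak f_m)\otimes\mathcal{PD}(\mathbb C^m\otimes\mathbb C^n)$ is $S_{ij}(u)\mapsto\delta_{ij}+\sum_{|c|,|d|=1}^mF_{cd}(u\pm\frac12+m)\otimes p_{ci}q_{dj}$. For an $\mathfrak f_m$-module $V$, $\mathcal F_m(V)=V\otimes\mathcal P(\mathbb C^m\otimes\mathbb C^n)$, with $\mathrm X(\mathfrak g_n)$ acting via $\beta_m$ and $X\in\mathfrak f_m$ acting as $X\otimes1+1\otimes\zeta_n(X)$; these commute, so $\mathrm X(\mathfrak g_n)$ acts on $\operatorname{Hom}_{\mathfrak f_m}(L_{\bar\lambda},\mathcal F_m(L_{\bar\mu}))$ through the target. Howe duality and identification. Irreducible polynomial representations $W_\nu$ of $G_n$ are parametrized by partitions $\nu$ with $\nu'_1+\nu'_2\le n$ for $O_n$, $2\nu'_1\le n$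 for $Sp_n$ ($\nu'$ the conjugate partition). As bimodules over $\mathfrak f_m$ and $G_n$, $\mathcal P(\mathbb C^m\otimes\mathbb C^n)=\bigoplus_\nu L_{\bar\nu}\otimes W_\nu$, over such $\nu$ with $\nu'_1\le m$, where $\bar\nu$ has labels $(-\frac n2-\nu_m,\dots,-\frac n2-\nu_1)$. Thus $\bar\lambda$ has labels $(-\frac{n+l}2-\lambda_m,\dots,-\frac{n+l}2-\lambda_1)$ and $\bar\mu$ has labels $(-\frac l2-\mu_m,\dots,-\frac l2-\mu_1)$. Using $W_\lambda=\operatorname{Hom}_{\mathfrak f_m}(L_{\bar\lambda},\mathcal P(\mathbb C^m\otimes\mathbb C^{n+l}))$, $\mathcal P(\mathbb C^m\otimes\mathbb C^{n+l})=\mathcal P(\mathbb C^m\otimes\mathbb C^l)\otimes\mathcal P(\mathbb C^m\otimes\mathbb C^n)$ and $L_{\bar\mu}=\operatorname{Hom}_{G_l}(W_\mu,\mathcal P(\mathbb C^m\otimes\mathbb C^l))$, one identifies (uniquely up to rescaling) $\operatorname{Hom}_{G_l}(W_\mu,W_\lambda)$ with $\operatorname{Hom}_{\mathfrak f_m}(L_{\bar\lambda},L_{\bar\mu}\otimes\mathcal P(\mathbb C^m\otimes\mathbb C^n))$. The algebra $\mathrm C_l$ acts on $\operatorname{Hom}_{G_l}(W_\mu,W_\lambda)$ through the action of $\mathrm U(\mathfrak g_{n+l})$ on $W_\lambda$; $\mathrm X(\mathfrak g_n)$ acts on it via $\gamma_l$. *)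

(* Defs.v *)
From HB Require Import structures.
From mathcomp Require Import all_boot all_order all_fingroup all_algebra.
From mathcomp Require Import generic_quotient boolp reals.
From mathcomp Require Import complex mxtens mpoly.

Set Implicit Arguments.
Unset Strict Implicit.
Unset Printing Implicit Defensive.

Import GRing.Theory.
Local Open Scope ring_scope.
Local Open Scope quotient_scope.

(* Associative unital algebras over a field, given by a central structure map.
   MathComp's algType demands 1 != 0, which cannot be read off a presentation. *)
HB.mixin Record PzRing_isKAlgebra (K : fieldType) A of GRing.PzRing A := {
  scal : K -> A;
  scalD : {morph scal : a b / a + b};
  scalM : {morph scal : a b / a * b};
  scal1 : scal 1 = 1;
  scalC : forall a x, scal a * x = x * scal a
}.

#[short(type="kalgType")]
HB.structure Definition KAlgebra (K : fieldType) :=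
  {A of GRing.PzRing A & PzRing_isKAlgebra K A}.

Lemma scalN (K : fieldType) (A : kalgType K) (c : K) : scal (- c) = - scal c :> A.
Proof.
have s0 : scal 0 = 0 :> A.
  by apply: (addrI (scal 0)); rewrite -scalD !addr0.
by apply/eqP; rewrite -addr_eq0 -scalD addNr s0.
Qed.

Definition alg_morph (K : fieldType) (A B : kalgType K) (f : A -> B) : Prop :=
  [/\ {morph f : x y / x + y}, monoid_morphism f
    & forall c : K, f (scal c) = scal c].

Definition is_action (K : fieldType) (A : kalgType K) (V : lmodType K)
    (act : A -> V -> V) : Prop :=
  [/\ forall a, linear (act a), forall a b v, act (a + b) v = act a v + act b v,
      forall (c : K) v, act (scal c) v = c *: v
    & forall a b v, act (a * b) v = act a (act b v)].

(* The algebra presented by generators G and relations rels.  Its elements are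
   classes of formal sums of scaled words; two of them are equal when they take
   the same value for every family of elements, in every algebra, that satisfies
   the relations. *)
Section Presented.
Context {K : fieldType} {G : choiceType}.
Variable rels : forall B : kalgType K, (G -> B) -> Prop.

Notation sum_of_words := (seq (K * seq G)).

Definition word_eval (B : kalgType K) (g : G -> B) (s : sum_of_words) : B :=
  \sum_(cw <- s) scal cw.1 * \prod_(x <- cw.2) g x.

Definition pres_eqv (s t : sum_of_words) : bool :=
  `[< forall (B : kalgType K) (g : G -> B),
        rels g -> word_eval g s = word_eval g t >].

Lemma pres_eqv_refl : reflexive pres_eqv. Proof. by move=> s; apply/asboolP. Qed.
Lemma pres_eqv_sym : ssrbool.symmetric pres_eqv.
Proof.
by move=> s t; apply/idP/idP => /asboolP h; apply/asboolP => B g hg; rewrite h.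
Qed.
Lemma pres_eqv_trans : transitive pres_eqv.
Proof.
by move=> t s u /asboolP h /asboolP h'; apply/asboolP => B g hg; rewrite h ?h'.
Qed.
Canonical pres_equiv := EquivRel pres_eqv pres_eqv_refl pres_eqv_sym pres_eqv_trans.

Definition presented := {eq_quot pres_eqv}.
HB.instance Definition _ := Choice.on presented.
HB.instance Definition _ := EqQuotient.on presented.

Definition pres_eval (B : kalgType K) (g : G -> B) (x : presented) : B :=
  word_eval g (repr x).

Lemma pres_evalE (B : kalgType K) (g : G -> B) s : rels g ->
  pres_eval g (\pi_presented s) = word_eval g s.
Proof.
move=> hg; have : \pi_presented (repr (\pi_presented s)) = \pi_presented s
  by rewrite reprK.
by move=> /eqmodP /asboolP /(_ B g hg).
Qed.

Lemma pres_evalP (x y : presented) :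
  (forall (B : kalgType K) (g : G -> B), rels g -> pres_eval g x = pres_eval g y) ->
  x = y.
Proof.
move=> h; rewrite -[x]reprK -[y]reprK; apply/eqmodP/asboolP => B g hg; exact: h.
Qed.

Definition pres_zero : presented := \pi_presented [::].
Definition pres_scal (c : K) : presented := \pi_presented [:: (c, [::])].
Definition pres_add (x y : presented) : presented := \pi_presented (repr x ++ repr y).
Definition pres_mul (x y : presented) : presented :=
  \pi_presented [seq (cw.1 * dv.1, cw.2 ++ dv.2) | cw <- repr x, dv <- repr y].
Definition pres_opp := pres_mul (pres_scal (-1)).
Definition pres_gen (x : G) : presented := \pi_presented [:: (1, [:: x])].

Section Eval.
Variables (B : kalgType K) (g : G -> B).
Hypothesis hg : rels g.

Lemma pres_eval0 : pres_eval g pres_zero = 0.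
Proof. by rewrite pres_evalE // /word_eval big_nil. Qed.
Lemma pres_eval_scal c : pres_eval g (pres_scal c) = scal c.
Proof. by rewrite pres_evalE // /word_eval big_seq1 big_nil mulr1. Qed.
Lemma pres_evalD x y :
  pres_eval g (pres_add x y) = pres_eval g x + pres_eval g y.
Proof. by rewrite pres_evalE // /word_eval big_cat. Qed.
Lemma pres_evalM x y : pres_eval g (pres_mul x y) = pres_eval g x * pres_eval g y.
Proof.
rewrite pres_evalE // /word_eval big_allpairs_dep mulr_suml.
apply: eq_bigr => cw _; rewrite mulr_sumr; apply: eq_bigr => dv _ /=.
by rewrite big_cat /= scalM -!mulrA; congr (_ * _); rewrite !mulrA (scalC dv.1).
Qed.
Lemma pres_evalN x : pres_eval g (pres_opp x) = - pres_eval g x.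
Proof.
by rewrite pres_evalM pres_eval_scal scalN scal1 mulN1r.
Qed.
Lemma pres_eval_gen x : pres_eval g (pres_gen x) = g x.
Proof. by rewrite pres_evalE // /word_eval big_seq1 big_seq1 scal1 mul1r. Qed.
End Eval.

Let evalE := (pres_eval0, pres_eval_scal, pres_evalD, pres_evalN, pres_evalM).
Ltac pres := move=> *; apply: pres_evalP => B g hg; rewrite ?evalE //.

Fact pres_addA : associative pres_add. Proof. by pres; rewrite addrA. Qed.
Fact pres_addC : commutative pres_add. Proof. by pres; rewrite addrC. Qed.
Fact pres_add0 : left_id pres_zero pres_add. Proof. by pres; rewrite add0r. Qed.
Fact pres_addN : left_inverse pres_zero pres_opp pres_add.
Proof. by pres; rewrite addNr. Qed.
HB.instance Definition _ :=
  GRing.isZmodule.Build presented pres_addA pres_addC pres_add0 pres_addN.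

Fact pres_mulA : associative pres_mul. Proof. by pres; rewrite mulrA. Qed.
Fact pres_mul1 : left_id (pres_scal 1) pres_mul.
Proof. by pres; rewrite scal1 mul1r. Qed.
Fact pres_mulr1 : right_id (pres_scal 1) pres_mul.
Proof. by pres; rewrite scal1 mulr1. Qed.
Fact pres_mulDl : left_distributive pres_mul +%R.
Proof. by pres; rewrite mulrDl. Qed.
Fact pres_mulDr : right_distributive pres_mul +%R.
Proof. by pres; rewrite mulrDr. Qed.
HB.instance Definition _ := GRing.Zmodule_isPzRing.Build presented
  pres_mulA pres_mul1 pres_mulr1 pres_mulDl pres_mulDr.

Fact pres_scalD : {morph pres_scal : a b / a + b >-> a + b}.
Proof. by pres; rewrite scalD. Qed.
Fact pres_scalM : {morph pres_scal : a b / a * b >-> a * b}.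
Proof. by pres; rewrite scalM. Qed.
Fact pres_scalC a (x : presented) : pres_scal a * x = x * pres_scal a.
Proof. by pres; rewrite scalC. Qed.
HB.instance Definition _ := PzRing_isKAlgebra.Build K presented
  pres_scalD pres_scalM erefl pres_scalC.

Lemma pres_eval_morph (B : kalgType K) (g : G -> B) :
  rels g -> alg_morph (pres_eval g).
Proof.
move=> hg; split; [exact: pres_evalD| |exact: pres_eval_scal].
by split; [rewrite pres_eval_scal ?scal1|exact: pres_evalM].
Qed.
End Presented.

(* Tensor product of vector spaces: finite sums of pure tensors, two of them
   being equal when no bilinear map tells them apart. *)
Section Tensor.
Context {K : fieldType}.
Variables V W : lmodType K.

Definition bilin (U : lmodType K) (f : V -> W -> U) : Prop :=
  (forall w, linear (f^~ w)) /\ (forall v, linear (f v)).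

Definition pairing (U : lmodType K) (f : V -> W -> U) (s : seq (V * W)) : U :=
  \sum_(vw <- s) f vw.1 vw.2.

Definition tens_eqv (s t : seq (V * W)) : bool :=
  `[< forall (U : lmodType K) (f : V -> W -> U), bilin f -> pairing f s = pairing f t >].

Lemma tens_eqv_refl : reflexive tens_eqv. Proof. by move=> s; apply/asboolP. Qed.
Lemma tens_eqv_sym : ssrbool.symmetric tens_eqv.
Proof.
by move=> s t; apply/idP/idP => /asboolP h; apply/asboolP => U f hf; rewrite h.
Qed.
Lemma tens_eqv_trans : transitive tens_eqv.
Proof.
by move=> t s u /asboolP h /asboolP h'; apply/asboolP => U f hf; rewrite h ?h'.
Qed.
Canonical tens_equiv :=
  EquivRel tens_eqv tens_eqv_refl tens_eqv_sym tens_eqv_trans.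

Definition tensor := {eq_quot tens_eqv}.
HB.instance Definition _ := Choice.on tensor.
HB.instance Definition _ := EqQuotient.on tensor.

Definition tens_lift (U : lmodType K) (f : V -> W -> U) (x : tensor) : U :=
  pairing f (repr x).

Lemma tens_liftE (U : lmodType K) (f : V -> W -> U) s : bilin f ->
  tens_lift f (\pi_tensor s) = pairing f s.
Proof.
move=> hf; have : \pi_tensor (repr (\pi_tensor s)) = \pi_tensor s by rewrite reprK.
by move=> /eqmodP /asboolP /(_ U f hf).
Qed.

Lemma tens_liftP (x y : tensor) :
  (forall (U : lmodType K) (f : V -> W -> U), bilin f ->
     tens_lift f x = tens_lift f y) -> x = y.
Proof.
move=> h; rewrite -[x]reprK -[y]reprK; apply/eqmodP/asboolP => U f hf; exact: h.
Qed.

Definition tens_zero : tensor := \pi_tensor [::].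
Definition tens_add (x y : tensor) : tensor := \pi_tensor (repr x ++ repr y).
Definition tens_scale (c : K) (x : tensor) : tensor :=
  \pi_tensor [seq (c *: vw.1, vw.2) | vw <- repr x].
Definition tens_opp := tens_scale (-1).
Definition tens (v : V) (w : W) : tensor := \pi_tensor [:: (v, w)].

Section Lift.
Variables (U : lmodType K) (f : V -> W -> U).
Hypothesis hf : bilin f.

Lemma tens_lift0 : tens_lift f tens_zero = 0.
Proof. by rewrite tens_liftE // /pairing big_nil. Qed.
Lemma tens_liftD x y : tens_lift f (tens_add x y) = tens_lift f x + tens_lift f y.
Proof. by rewrite tens_liftE // /pairing big_cat. Qed.
Lemma tens_liftZ c x : tens_lift f (tens_scale c x) = c *: tens_lift f x.
Proof.
rewrite tens_liftE // /pairing big_map scaler_sumr; apply: eq_bigr => vw _ /=.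
have f0 w : f 0 w = 0.
  by have := hf.1 w (-1) 0 0; rewrite scaler0 addr0 scaleN1r addNr.
by have := hf.1 vw.2 c vw.1 0; rewrite !addr0 f0 addr0.
Qed.
Lemma tens_lift_tens v w : tens_lift f (tens v w) = f v w.
Proof. by rewrite tens_liftE // /pairing big_seq1. Qed.
End Lift.

Let liftE := (tens_lift0, tens_liftD, tens_liftZ, tens_lift_tens).
Ltac tens := move=> *; apply: tens_liftP => U f hf; rewrite ?liftE //.

Fact tens_addA : associative tens_add. Proof. by tens; rewrite addrA. Qed.
Fact tens_addC : commutative tens_add. Proof. by tens; rewrite addrC. Qed.
Fact tens_add0 : left_id tens_zero tens_add. Proof. by tens; rewrite add0r. Qed.
Fact tens_addN : left_inverse tens_zero tens_opp tens_add.
Proof. by tens; rewrite scaleN1r addNr. Qed.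
HB.instance Definition _ :=
  GRing.isZmodule.Build tensor tens_addA tens_addC tens_add0 tens_addN.

Fact tens_scaleA a b x : tens_scale a (tens_scale b x) = tens_scale (a * b) x.
Proof. by tens; rewrite scalerA. Qed.
Fact tens_scale1 : left_id 1 tens_scale. Proof. by tens; rewrite scale1r. Qed.
Fact tens_scaleDr : right_distributive tens_scale +%R.
Proof. by tens; rewrite scalerDr. Qed.
Fact tens_scaleDl x : {morph tens_scale^~ x : a b / a + b >-> a + b}.
Proof. by tens; rewrite scalerDl. Qed.
HB.instance Definition _ := GRing.Zmodule_isLmodule.Build K tensor
  tens_scaleA tens_scale1 tens_scaleDr tens_scaleDl.

Lemma tens_lift_linear (U : lmodType K) (f : V -> W -> U) :
  bilin f -> linear (tens_lift f).
Proof. by move=> hf c x y; rewrite tens_liftD // tens_liftZ. Qed.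

Lemma tens_bilin : bilin tens.
Proof.
split=> z c x y; apply: tens_liftP => U f hf; rewrite !liftE //.
- exact: hf.1.
- exact: hf.2.
Qed.
End Tensor.
Notation "V ⊗ W" := (tensor V W) (at level 40, left associativity) : type_scope.
Notation "v ⊗ w" := (tens v w) (at level 40, left associativity) : ring_scope.

Definition tens_map (K : fieldType) (V V' W W' : lmodType K)
    (f : V -> V') (g : W -> W') : V ⊗ W -> V' ⊗ W' :=
  tens_lift (fun v w => f v ⊗ g w).

(* Tensor product of algebras: the universal algebra receiving A and B with
   commuting images. *)
Section TensorAlgebra.
Context {K : fieldType}.
Variables A B : kalgType K.

Definition tens_alg := presented (fun (C : kalgType K) (g : A + B -> C) =>
  [/\ alg_morph (g \o inl), alg_morph (g \o inr)
    & forall a b, g (inl a) * g (inr b) = g (inr b) * g (inl a)]).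
HB.instance Definition _ := KAlgebra.on tens_alg.

Definition tens_algl (a : A) : tens_alg := pres_gen _ (inl a).
Definition tens_algr (b : B) : tens_alg := pres_gen _ (inr b).

Definition is_tens_action (V W : lmodType K) (aA : A -> V -> V) (aB : B -> W -> W)
    (act : tens_alg -> V ⊗ W -> V ⊗ W) : Prop :=
  is_action act /\
  forall a b v w, act (tens_algl a * tens_algr b) (v ⊗ w) = aA a v ⊗ aB b w.
End TensorAlgebra.

(* Differential operators with polynomial coefficients, as operators on the
   polynomial ring. *)
Section DifferentialOperators.
Context (K : fieldType) (k : nat).
Notation P := {mpoly K[k]}.

Inductive diffop : (P -> P) -> Prop :=
| diffop_scal c : diffop (fun p => c *: p)
| diffop_var i : diffop (fun p => 'X_i * p)
| diffop_der i : diffop (mderiv i)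
| diffop_add D E : diffop D -> diffop E -> diffop (fun p => D p + E p)
| diffop_comp D E : diffop D -> diffop E -> diffop (fun p => D (E p)).

Record PD := MkPD { pd_fun :> P -> P; pd_funP : diffop pd_fun }.
HB.instance Definition _ := gen_eqMixin PD.
HB.instance Definition _ := gen_choiceMixin PD.

Lemma pd_ext (D E : PD) : D =1 E -> D = E.
Proof.
case: D E => [D hD] [E hE] /= /funext h; rewrite -h in hE *.
by congr MkPD; exact: Prop_irrelevance.
Qed.

Lemma pd_linear (D : PD) : linear D.
Proof.
case: D => D /=; elim=> {D} [c|i|i|D E _ hD _ hE|D E _ hD _ hE] a p q.
- by rewrite scalerDr !scalerA mulrC.
- by rewrite mulrDr scalerAr.
- by rewrite linearP.
- by rewrite hD hE scalerDr addrACA.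
- by rewrite hE hD.
Qed.

Definition pd_scal (c : K) : PD := MkPD (diffop_scal c).
Definition pd_var i : PD := MkPD (diffop_var i).
Definition pd_der i : PD := MkPD (diffop_der i).
Definition pd_add (D E : PD) : PD := MkPD (diffop_add (pd_funP D) (pd_funP E)).
Definition pd_mul (D E : PD) : PD := MkPD (diffop_comp (pd_funP D) (pd_funP E)).
Definition pd_opp := pd_mul (pd_scal (-1)).

Ltac pd := move=> *; apply: pd_ext => p /=.

Fact pd_addA : associative pd_add. Proof. by pd; rewrite addrA. Qed.
Fact pd_addC : commutative pd_add. Proof. by pd; rewrite addrC. Qed.
Fact pd_add0 : left_id (pd_scal 0) pd_add.
Proof. by pd; rewrite scale0r add0r. Qed.
Fact pd_addN : left_inverse (pd_scal 0) pd_opp pd_add.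
Proof. by pd; rewrite scale0r scaleN1r addNr. Qed.
HB.instance Definition _ := GRing.isZmodule.Build PD pd_addA pd_addC pd_add0 pd_addN.

Fact pd_mulA : associative pd_mul. Proof. by pd. Qed.
Fact pd_mul1 : left_id (pd_scal 1) pd_mul. Proof. by pd; rewrite scale1r. Qed.
Fact pd_mulr1 : right_id (pd_scal 1) pd_mul. Proof. by pd; rewrite scale1r. Qed.
Fact pd_mulDl : left_distributive pd_mul +%R. Proof. by pd. Qed.
Fact pd_mulDr : right_distributive pd_mul +%R.
Proof.
move=> D E F; apply: pd_ext => p /=.
by have := pd_linear D 1 (E p) (F p); rewrite !scale1r.
Qed.
HB.instance Definition _ := GRing.Zmodule_isPzRing.Build PD
  pd_mulA pd_mul1 pd_mulr1 pd_mulDl pd_mulDr.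

Fact pd_scalD : {morph pd_scal : a b / a + b >-> a + b}.
Proof. by pd; rewrite scalerDl. Qed.
Fact pd_scalM : {morph pd_scal : a b / a * b >-> a * b}.
Proof. by pd; rewrite scalerA. Qed.
Fact pd_scalC a (D : PD) : pd_scal a * D = D * pd_scal a.
Proof.
apply: pd_ext => p /=; have D0 : D 0 = 0.
  by have := pd_linear D (-1) 0 0; rewrite scaler0 addr0 scaleN1r addNr.
by have := pd_linear D a p 0; rewrite !addr0 D0 addr0.
Qed.
HB.instance Definition _ := PzRing_isKAlgebra.Build K PD
  pd_scalD pd_scalM erefl pd_scalC.
End DifferentialOperators.

(* Formal power series in u^-1: a series is the function giving the coefficient
   of u^-k for each k. *)
Section Series.
Context {K : fieldType}.

Definition ser_one (k : nat) : K := (k == 0)%:R.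

Definition ser_mul (a b : nat -> K) (k : nat) : K :=
  \sum_(r < k.+1) a r * b (k - r)%N.

(* (e u + c)^-1 = e^-1 u^-1 (1 + (c / e) u^-1)^-1 *)
Definition inv_affine (e c : K) (k : nat) : K :=
  if k is k'.+1 then e^-1 * (- (c / e)) ^+ k' else 0.

(* s(e u + c) *)
Definition ser_subst (A : kalgType K) (e c : K) (s : nat -> A) (k : nat) : A :=
  \sum_(r < k.+1) scal (iter r (ser_mul (inv_affine e c)) ser_one k) * s r.

Definition smx_one (A : pzRingType) N (k : nat) : 'M[A]_N :=
  if k is 0 then 1%:M else 0.

Definition smx_mul (A : pzRingType) N (S T : nat -> 'M[A]_N) (k : nat) : 'M[A]_N :=
  \sum_(r < k.+1) S r *m T (k - r)%N.

Definition smx_subst (A : kalgType K) N (e c : K) (S : nat -> 'M[A]_N) (k : nat) :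
  'M[A]_N := \matrix_(i, j) ser_subst e c (fun r => S r i j) k.

Definition smx_inverse (A : pzRingType) N (S T : nat -> 'M[A]_N) : Prop :=
  smx_mul S T =1 @smx_one A N /\ smx_mul T S =1 @smx_one A N.
End Series.

(* The orthogonal and the symplectic case; pm is the double sign +-. *)
Inductive gtype := Orth | Symp.

Definition pm (K : fieldType) (G : gtype) : K := if G is Orth then 1 else -1.

(* The form <e_i, e_j> = theta_i delta_{tilde i, j}. *)
Record formdata (K : fieldType) N := Form { tl : 'I_N -> 'I_N; th : 'I_N -> K }.

Section Forms.
Context {K : fieldType}.

(* Indices start at 0, so the parity is opposite to that of indices starting
   at 1; insubd i keeps the last i fixed when i.+1 is out of range. *)
Definition std_form (G : gtype) N : formdata K N :=
  Form (fun i => insubd i (if odd i then i.-1 else i.+1))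
       (fun i => if G is Orth then 1 else (-1) ^+ i).

Definition form_sum n l (D : formdata K n) (E : formdata K l) : formdata K (n + l) :=
  Form (fun k => match split k with
                 | inl i => lshift l (tl D i) | inr j => rshift n (tl E j) end)
       (fun k => match split k with inl i => th D i | inr j => th E j end).

Definition gram N (D : formdata K N) : 'M[K]_N :=
  \matrix_(i, j) (th D i *+ (tl D i == j)).

Definition in_isom_group N (D : formdata K N) (g : 'M[K]_N) : bool :=
  g^T *m gram D *m g == gram D.

Definition lie_isometry N (D : formdata K N) : {vspace 'M[K]_N} :=
  lker (linfun (fun A : 'M[K]_N => A^T *m gram D + gram D *m A)).
End Forms.

Section Envelopes.
Context {K : fieldType}.

Definition env N (g : {vspace 'M[K]_N}) :=
  presented (fun (B : kalgType K) (x : subvs_of g -> B) =>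
    (forall c a b, x (c *: a + b) = scal c * x a + x b) /\
    (forall a b c, val c = val a *m val b - val b *m val a ->
       x c = x a * x b - x b * x a)).
HB.instance Definition _ N (g : {vspace 'M[K]_N}) := KAlgebra.on (env g).

Definition env_gen N (g : {vspace 'M[K]_N}) (A : 'M[K]_N) : env g :=
  pres_gen _ (vsproj g A).

(* E_ij - theta_i theta_j E_{tilde j, tilde i} *)
Definition Fhat N (D : formdata K N) (i j : 'I_N) : env (lie_isometry D) :=
  env_gen _ (delta_mx i j - (th D i * th D j) *: delta_mx (tl D j) (tl D i)).
End Envelopes.

Section TwistedYangian.
Context {K : fieldType} {N : nat} (D : formdata K N).

Section ReflectionEquation.
Variables (B : kalgType K) (S : nat -> 'M[B]_N).

Definition coef (r : int) : 'M[B]_N := if r is Posz k then S k else 0.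
Definition S1 (r : int) : 'M[B]_(N * N) := coef r *t 1%:M.
Definition S2 (s : int) : 'M[B]_(N * N) := 1%:M *t coef s.
Definition opP : 'M[B]_(N * N) := \sum_i \sum_j delta_mx i j *t delta_mx j i.
Definition opQ : 'M[B]_(N * N) :=
  \sum_i \sum_j scal (th D i * th D j) *: (delta_mx i j *t delta_mx (tl D i) (tl D j)).

(* The coefficients at u^-r v^-s of S_1(u) R'(-u-v) S_2(v) and of
   S_2(v) R'(-u-v) S_1(u), where R(u) = u - opP and R'(u) = u - opQ. *)
Definition refl_l (r s : int) : 'M[B]_(N * N) :=
  - S1 (r + 1) *m S2 s - S1 r *m S2 (s + 1) - S1 r *m opQ *m S2 s.
Definition refl_r (r s : int) : 'M[B]_(N * N) :=
  - S2 s *m S1 (r + 1) - S2 (s + 1) *m S1 r - S2 s *m opQ *m S1 r.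

(* R(u-v) S_1(u) R'(-u-v) S_2(v) = S_2(v) R'(-u-v) S_1(u) R(u-v) *)
Definition reflection_equation : Prop := forall r s : int,
  refl_l (r + 1) s - refl_l r (s + 1) - opP *m refl_l r s =
  refl_r (r + 1) s - refl_r r (s + 1) - refl_r r s *m opP.
End ReflectionEquation.

(* The generator S_ij^(r), r >= 1, is indexed by (r.-1, i, j). *)
Definition gen_series (B : kalgType K) (g : nat * 'I_N * 'I_N -> B) (k : nat) :
  'M[B]_N := if k is r.+1 then \matrix_(i, j) g (r, i, j) else 1%:M.

Definition XYangian :=
  presented (fun (B : kalgType K) (g : nat * 'I_N * 'I_N -> B) =>
    reflection_equation (gen_series g)).
HB.instance Definition _ := KAlgebra.on XYangian.

Definition Sgen (k : nat) : 'M[XYangian]_N := gen_series (fun x => pres_gen _ x) k.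

(* S(u) |-> f(u) S(u) *)
Definition is_rescaling (f : nat -> K) (t : XYangian -> XYangian) : Prop :=
  alg_morph t /\
  forall k i j, t (Sgen k i j) = \sum_(r < k.+1) scal (f r) * Sgen (k - r)%N i j.

(* S(u) |-> S(-u - N/2)^-1 *)
Definition is_omega (om : XYangian -> XYangian) : Prop :=
  alg_morph om /\
  smx_inverse (fun k => map_mx om (Sgen k)) (smx_subst (-1) (- (N%:R / 2%:R)) Sgen).

(* S_ij(u) |-> delta_ij + (E_ij - theta_i theta_j E_{tilde j, tilde i}) / (u +- 1/2) *)
Definition is_pi (G : gtype) (f : XYangian -> env (lie_isometry D)) : Prop :=
  alg_morph f /\ forall k i j,
    f (Sgen k i j) = scal (ser_one k *+ (i == j)) +
                     scal (inv_affine 1 (pm K G / 2%:R) k) * Fhat D i j.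
End TwistedYangian.

Section Olshanski.
Context {K : fieldType} (G : gtype) (n l : nat).

Definition dataN : formdata K n := std_form G n.
Definition dataL : formdata K l := std_form G l.
Definition dataNL : formdata K (n + l) := form_sum dataN dataL.

Definition is_iota (io : XYangian dataN -> XYangian dataNL) : Prop :=
  alg_morph io /\
  forall k i j, io (Sgen dataN k i j) = Sgen dataNL k (lshift l i) (lshift l j).

Definition is_olshanski
    (gamma : XYangian dataN -> env (lie_isometry dataNL)) : Prop :=
  exists (om : XYangian dataN -> XYangian dataN)
         (io : XYangian dataN -> XYangian dataNL)
         (om' : XYangian dataNL -> XYangian dataNL)
         (p : XYangian dataNL -> env (lie_isometry dataNL)),
    [/\ is_omega om, is_iota io, is_omega om', is_pi G p
      & gamma =1 p \o om' \o io \o om].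
End Olshanski.
Arguments dataN : clear implicits.
Arguments dataL : clear implicits.
Arguments dataNL : clear implicits.

(* f_m = sp_2m for O_n and so_2m for Sp_n.  The indices -m..-1, 1..m are encoded
   increasingly by 'I_(m + m), so that rev_ord is negation. *)
Section DualLieAlgebra.
Context {K : fieldType} (G : gtype) (m : nat).

Definition isneg (a : 'I_(m + m)) : bool := (a < m)%N.

Definition absi (a : 'I_(m + m)) : 'I_m :=
  match split a with inl i => rev_ord i | inr j => j end.

Definition eps (a b : 'I_(m + m)) : K :=
  if G is Orth then (-1) ^+ isneg a * (-1) ^+ isneg b else 1.

Definition Fmx (a b : 'I_(m + m)) : 'M[K]_(m + m) :=
  delta_mx a b - eps a b *: delta_mx (rev_ord b) (rev_ord a).

Definition fm : {vspace 'M[K]_(m + m)} := (\sum_a \sum_b <[Fmx a b]>)%VS.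

Definition Fgen (a b : 'I_(m + m)) : env fm := env_gen fm (Fmx a b).

(* F(u) = (u - F)^-1 = sum_k F^k u^-(k+1) *)
Definition resolvent (k : nat) : 'M[env fm]_(m + m) :=
  if k is k'.+1 then iter k' (mulmx (\matrix_(a, b) Fgen a b)) 1%:M else 0.

Definition simple_fm_module (L : lmodType K) (act : env fm -> L -> L) : Prop :=
  [/\ is_action act, exists v : L, v != 0
    & forall Q : L -> Prop,
        Q 0 -> (forall c v w, Q v -> Q w -> Q (c *: v + w)) ->
        (forall x v, Q v -> Q (act x v)) ->
        (forall v, Q v -> v = 0) \/ (forall v, Q v)].

(* kappa i is the label kappa_(i+1) = kappa(F_(i-m, i-m)), 0 <= i < m. *)
Definition has_highest_weight (L : lmodType K) (act : env fm -> L -> L)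
    (kappa : 'I_m -> K) : Prop :=
  exists v : L, [/\ v != 0,
    forall a b : 'I_(m + m), (a < b)%N -> act (Fgen a b) v = 0
    & forall i, act (Fgen (lshift m i) (lshift m i)) v = kappa i *: v].

Definition is_simple_hw (L : lmodType K) (act : env fm -> L -> L)
    (kappa : 'I_m -> K) : Prop :=
  simple_fm_module act /\ has_highest_weight act kappa.

(* Linear maps L -> T intertwining the actions of the F_ab, which span f_m. *)
Definition fm_hom (L T : lmodType K) (act : env fm -> L -> L)
    (z : 'I_(m + m) -> 'I_(m + m) -> T -> T) (phi : L -> T) : Prop :=
  linear phi /\ forall a b v, phi (act (Fgen a b) v) = z a b (phi v).
End DualLieAlgebra.
Arguments fm : clear implicits.

(* P(C^m (x) C^N), with x_ai the variable of index mxtens_index (a, i). *)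
Notation Pol K m N := {mpoly K[m * N]}.

Section Polynomials.
Context {K : fieldType} {m N : nat}.
Notation P := (Pol K m N).

Definition xv (a : 'I_m) (i : 'I_N) : P := 'X_(mxtens_index (a, i)).
Definition dv (a : 'I_m) (i : 'I_N) : P -> P := mderiv (mxtens_index (a, i)).

Definition subst_vars k (F : 'I_m -> 'I_N -> {mpoly K[k]}) (p : P) : {mpoly K[k]} :=
  p \mPo [tuple F (mxtens_unindex j).1 (mxtens_unindex j).2 | j < m * N].

(* The natural action of matrices, e_j |-> \sum_i g_ij e_i on C^N. *)
Definition pol_act (g : 'M[K]_N) : P -> P :=
  subst_vars (fun a j => \sum_i g i j *: xv a i).

Variables (G : gtype) (D : formdata K N).

Definition zeta (a b : 'I_(m + m)) (p : P) : P :=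
  let a' := absi a in let b' := absi b in
  match isneg a, isneg b with
  | false, false =>
      (N%:R / 2%:R *+ (a' == b')) *: p + \sum_k xv a' k * dv b' k p
  | false, true => - \sum_k th D k *: (xv a' (tl D k) * xv b' k * p)
  | true, false => \sum_k th D k *: dv a' k (dv b' (tl D k) p)
  | true, true => (* F_(-a', -b') = - F_(b', a') *)
      - ((N%:R / 2%:R *+ (a' == b')) *: p + \sum_k xv b' k * dv a' k p)
  end.

Definition pop (c : 'I_(m + m)) (i : 'I_N) : PD K (m * N) :=
  if isneg c then pd_var K (mxtens_index (absi c, i))
  else scal (- th D i) * pd_der K (mxtens_index (absi c, tl D i)).

Definition qop (c : 'I_(m + m)) (i : 'I_N) : PD K (m * N) :=
  if isneg c then pd_der K (mxtens_index (absi c, i))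
  else scal (th D i) * pd_var K (mxtens_index (absi c, tl D i)).

(* S_ij(u) |-> delta_ij + \sum_(c, d) F_cd(u +- 1/2 + m) (x) p_ci q_dj *)
Definition is_beta
    (be : XYangian D -> tens_alg (env (fm K G m)) (PD K (m * N))) : Prop :=
  alg_morph be /\ forall k i j,
    be (Sgen D k i j) = scal (ser_one k *+ (i == j)) +
      \sum_c \sum_d
        tens_algl _ (ser_subst 1 (pm K G / 2%:R + m%:R)
                       (fun r => resolvent G m r c d) k) *
        tens_algr _ (pop c i * qop d j).

(* The action X (x) 1 + 1 (x) zeta(X) of X = F_ab on V (x) P. *)
Definition diag_act (V : lmodType K) (act : env (fm K G m) -> V -> V)
    (a b : 'I_(m + m)) (t : V ⊗ P) : V ⊗ P :=
  tens_map (act (Fgen G a b)) id t + tens_map id (zeta a b) t.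
End Polynomials.

(* Partitions are nonincreasing sequences of positive integers; conj_part nu j
   is nu'_j for j >= 1. *)
Definition is_part (nu : seq nat) : bool := sorted geq nu && (0 \notin nu).

Definition conj_part (nu : seq nat) (j : nat) : nat := count (leq j) nu.

Definition is_param (G : gtype) (N : nat) (nu : seq nat) : bool :=
  is_part nu &&
  if G is Orth then (conj_part nu 1 + conj_part nu 2 <= N)%N
  else (2 * conj_part nu 1 <= N)%N.

Section Representations.
Context {K : fieldType} {N : nat} (D : formdata K N).
Variables (W : vectType K) (rho : 'M[K]_N -> 'End(W)).

Definition mx_eval (p : {mpoly K[N * N]}) (g : 'M[K]_N) : K :=
  p.@[fun k => g (mxtens_unindex k).1 (mxtens_unindex k).2].

(* Only the values of rho on the group of isometries of D matter. *)
Definition is_group_rep : Prop :=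
  rho 1%:M = \1%VF /\
  forall g h, in_isom_group D g -> in_isom_group D h -> rho (g *m h) = (rho g \o rho h)%VF.

(* p restricts to the matrix coefficient of rho at f and w. *)
Definition represents (p : {mpoly K[N * N]}) (f : 'Hom(W, K^o)) (w : W) : Prop :=
  forall g, in_isom_group D g -> f (rho g w) = mx_eval p g.

Definition is_polynomial : Prop := forall f w, exists p, represents p f w.

Definition is_irreducible : Prop :=
  (fullv != 0 :> {vspace W})%VS /\
  forall U : {vspace W}, (forall g, in_isom_group D g -> (rho g @: U <= U)%VS) ->
    U = 0%VS \/ U = fullv.

(* act is the action of U(Lie algebra) obtained by differentiating rho at 1. *)
Definition is_differential (act : env (lie_isometry D) -> W -> W) : Prop :=
  is_action act /\
  forall (A : subvs_of (lie_isometry D)) (f : 'Hom(W, K^o)) w p,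
    represents p f w ->
    f (act (env_gen _ (val A)) w) =
    \sum_i \sum_j val A i j * mx_eval (mderiv (mxtens_index (i, j)) p) 1%:M.

(* Weyl's construction of the representation with parameter nu: the image of a
   Young symmetrizer on traceless tensors of degree d = |nu|. *)
Section Weyl.
Variable nu : seq nat.
Let d := sumn nu.

Definition tensors := {ffun {ffun 'I_d -> 'I_N} -> K^o}.

Definition tensors_act (g : 'M[K]_N) (t : tensors) : tensors :=
  [ffun s : {ffun 'I_d -> 'I_N} =>
     \sum_(s' : {ffun 'I_d -> 'I_N}) (\prod_k g (s k) (s' k)) * t s'].

Definition contraction (p q : 'I_d) (t : tensors) (s : {ffun 'I_d -> 'I_N}) : K :=
  \sum_a \sum_b gram D a b *
    t [ffun k => if k == p then a else if k == q then b else s k].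

Definition traceless (t : tensors) : Prop :=
  forall p q, p != q -> forall s, contraction p q t s = 0.

Definition row_stab : {set 'S_d} :=
  [set s : 'S_d | [forall k, reshape_index nu (s k) == reshape_index nu k]].
Definition col_stab : {set 'S_d} :=
  [set s : 'S_d | [forall k, reshape_offset nu (s k) == reshape_offset nu k]].

Definition young_symmetrizer (t : tensors) : tensors :=
  [ffun s : {ffun 'I_d -> 'I_N} => \sum_(p in row_stab) \sum_(q in col_stab)
     (-1) ^+ odd_perm q * t [ffun k => s (p (q k))]].

Definition has_parameter : Prop :=
  exists f : W -> tensors,
    [/\ linear f, injective f,
        forall t, (exists w, f w = t) <->
                  (exists2 t0, traceless t0 & t = young_symmetrizer t0)
      & forall g, in_isom_group D g -> forall w, f (rho g w) = tensors_act g (f w)].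
End Weyl.

Definition is_irrep_with_parameter (nu : seq nat) : Prop :=
  [/\ is_group_rep, is_polynomial, is_irreducible & has_parameter nu].
End Representations.

(* i identifies V with the space of all maps A -> B that satisfy H. *)
Definition is_hom_space (K : fieldType) (V A B : lmodType K) (H : (A -> B) -> Prop)
    (i : V -> A -> B) : Prop :=
  [/\ forall a, linear (i^~ a), forall v, (forall a, i v a = 0) -> v = 0,
      forall v, H (i v) & forall phi, H phi -> exists v, i v =1 phi].

Section Identification.
Context {K : fieldType} (G : gtype) (n l m : nat).

Notation Pn := (Pol K m n).
Notation Pl := (Pol K m l).
Notation Pnl := (Pol K m (n + l)).

Definition emb_n : Pn -> Pnl := subst_vars (fun a i => xv a (lshift l i)).
Definition emb_l : Pl -> Pnl := subst_vars (fun a i => xv a (rshift n i)).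

(* G_l acts on C^(n+l) by fixing C^n. *)
Definition emb_gl (h : 'M[K]_l) : 'M[K]_(n + l) := block_mx 1%:M 0 0 h.

Definition weight_of (N : nat) (nu : seq nat) (i : 'I_m) : K :=
  - (N%:R / 2%:R) - (nth 0%N nu (rev_ord i))%:R.

Variables (Wlam Wmu : vectType K) (rlam : 'M[K]_(n + l) -> 'End(Wlam))
  (rmu : 'M[K]_l -> 'End(Wmu)).
Variables (Llam Lmu : lmodType K) (alam : env (fm K G m) -> Llam -> Llam)
  (amu : env (fm K G m) -> Lmu -> Lmu).

(* W_lambda = Hom_{f_m}(L_lambda, P(C^m (x) C^(n+l))), equivariantly *)
Definition is_howe_lam (i : Wlam -> Llam -> Pnl) : Prop :=
  is_hom_space (fm_hom alam (zeta (dataNL K G n l))) i /\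
  forall g, in_isom_group (dataNL K G n l) g ->
    forall w v, i (rlam g w) v = pol_act g (i w v).

Definition gl_hom (T : lmodType K) (r : 'M[K]_l -> T -> T) (psi : Wmu -> T) : Prop :=
  linear psi /\
  forall h, in_isom_group (dataL K G l) h -> forall w, psi (rmu h w) = r h (psi w).

(* L_mu = Hom_{G_l}(W_mu, P(C^m (x) C^l)), equivariantly *)
Definition is_howe_mu (j : Lmu -> Wmu -> Pl) : Prop :=
  is_hom_space (gl_hom (fun h => pol_act h)) j /\
  forall a b v w, j (amu (Fgen G a b) v) w = zeta (dataL K G l) a b (j v w).

Definition source_hom (phi : Llam -> Lmu ⊗ Pn) : Prop :=
  fm_hom alam (diag_act (dataN K G n) amu) phi.

Definition target_hom (psi : Wmu -> Wlam) : Prop :=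
  gl_hom (fun h => rlam (emb_gl h)) psi.

(* phi and psi correspond to each other: applying an element of L_mu to w turns
   phi into a map with values in P(C^m (x) C^l) (x) P(C^m (x) C^n) =
   P(C^m (x) C^(n+l)), namely the one given by psi w. *)
Definition corresponds (i : Wlam -> Llam -> Pnl) (j : Lmu -> Wmu -> Pl)
    (phi : Llam -> Lmu ⊗ Pn) (psi : Wmu -> Wlam) : Prop :=
  forall w v, i (psi w) v = tens_lift (fun u p => emb_l (j u w) * emb_n p) (phi v).

(* f(u) = 1 + m (u - (l -+ 1) / 2)^-1 *)
Definition f_series (k : nat) : K :=
  ser_one k + m%:R * inv_affine 1 (- ((l%:R - pm K G) / 2%:R)) k.
End Identification.

(* Main.v *)
Require Import Defs.
From HB Require Import structures.
From mathcomp Require Import all_boot all_order all_fingroup all_algebra.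
From mathcomp Require Import generic_quotient boolp reals complex mxtens mpoly.
From mathcomp Require Import zify ring.

Set Implicit Arguments.
Unset Strict Implicit.
Unset Printing Implicit Defensive.

Import GRing.Theory.
Local Open Scope ring_scope.
Local Open Scope quotient_scope.

(** Both actions can be read off in the polynomial ring Pnl in the variables
    x_ai with a <= m and i <= n + l.  For w in Wmu, evaluating the elements of
    Lmu at w and multiplying polynomials gives a linear map [theta] w from
    Lmu ⊗ Pn to Pnl, and phi corresponds to psi when
    hlam (psi w) v = theta w (phi v) for all w and v.  Together the maps theta w
    separate tensors ([theta_inj]), and their joint image consists of the
    G_l-equivariant families of polynomials ([theta_surj]); since theta w
    intertwines the actions of f_m ([theta_diag]) this gives the bijection between
    the two spaces of homomorphisms.

    On Pnl everything is expressed by two matrices of differential operators,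
    P = (p_ic), with n + l rows, and Q = (q_ci), with n + l columns: the matrix of
    the E_ij - theta_i theta_j E_(j~ i~) acts as P Q + m ([env_dpol_Fhat]), and the
    matrix F of f_m acts on the variables of the last l columns as l/2 - Ql Pl
    ([zeta_qp]), where Pn, Pl, Qn, Ql are the blocks of P and Q.  Put
    u' = u - (l -+ 1)/2 and x = u' + m.  Unfolding the definition of gamma, S(u)
    acts as the inverse of the n by n corner of the inverse of 1 + (P Q + m) / u',
    that is, of the corner of u' (x + P Q)^-1 ([gamma_corner]).  Eliminating the
    last l rows of a linear system whose entries need not commute
    ([corner_inverse]) shows that this is
      (x / u') (1 + Pn (x + Ql Pl)^-1 Qn)        ([gamma_series]).
    The scalar x / u' = 1 + m / u' is f(u), and (x + Ql Pl)^-1 is what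
    (u +- 1/2 + m - F)^-1 becomes on the polynomials in the last l columns, so the
    matrix entries are those of f(u) beta(S(u)), read through theta
    ([theta_beta], [theta_action]).

    Two points connect this computation with the modules in the statement.  The
    action of the enveloping algebra on Wlam is the derivative of that of the
    group, hence hlam carries it to polarization operators
    ([differential_pol_act]).  And once the images of phi and psi under an element
    of the Yangian are known to correspond, they are automatically homomorphisms:
    the values of hlam intertwine f_m and theta is injective, and equivariance
    comes from uniqueness in the bijection ([actions_correspond]). *)

(** * Algebras *)

Section AlgMorph.
Context {K : fieldType}.
Variables A B : kalgType K.
Variable f : A -> B.
Hypothesis fP : alg_morph f.

Lemma alg_morphD x y : f (x + y) = f x + f y. Proof. by case: fP => h _ _; exact: h. Qed.
Lemma alg_morphM x y : f (x * y) = f x * f y. Proof. by case: fP => _ [_ h] _; exact: h. Qed.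
Lemma alg_morph1 : f 1 = 1. Proof. by case: fP => _ [h _] _. Qed.
Lemma alg_morph_scal c : f (scal c) = scal c. Proof. by case: fP => _ _ h; exact: h. Qed.
Lemma alg_morph0 : f 0 = 0. Proof. by apply: (addrI (f 0)); rewrite -alg_morphD !addr0. Qed.
Lemma alg_morph_sum I (r : seq I) (P : pred I) (F : I -> A) :
  f (\sum_(i <- r | P i) F i) = \sum_(i <- r | P i) f (F i).
Proof. by apply: (big_morph f alg_morphD alg_morph0). Qed.
End AlgMorph.

Lemma alg_morph_comp (K : fieldType) (A B C : kalgType K) (f : A -> B) (g : B -> C) :
  alg_morph f -> alg_morph g -> alg_morph (g \o f).
Proof.
move=> fP gP; split=> [x y|| c] /=; first by rewrite !alg_morphD.
  by split=> [|x y] /=; rewrite ?alg_morph1 ?alg_morphM.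
by rewrite !alg_morph_scal.
Qed.

Lemma scal0 (K : fieldType) (A : kalgType K) : scal 0 = 0 :> A.
Proof. by apply: (addrI (scal 0)); rewrite -scalD !addr0. Qed.

Lemma scal_sum (K : fieldType) (A : kalgType K) I (r : seq I) (P : pred I) (F : I -> K) :
  scal (\sum_(i <- r | P i) F i) = \sum_(i <- r | P i) scal (F i) :> A.
Proof. by apply: (big_morph (@scal K A)); [exact: scalD|exact: scal0]. Qed.

Lemma scal_nat (K : fieldType) (A : kalgType K) k : scal k%:R = k%:R :> A.
Proof. by elim: k => [|k IH]; rewrite ?scal0 // !mulrS scalD scal1 IH. Qed.

(** The universal property makes a presented algebra the span of the words in
    its generators: whatever is closed under the operations is everything. *)
Lemma presented_ind (K : fieldType) (G : choiceType)
    (rels : forall B : kalgType K, (G -> B) -> Prop) (Q : presented rels -> Prop) :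
  (forall c, Q (scal c)) -> (forall x, Q (pres_gen rels x)) ->
  (forall a b, Q a -> Q b -> Q (a + b)) -> (forall a b, Q a -> Q b -> Q (a * b)) ->
  forall a, Q a.
Proof.
move=> Qs Qg Qa Qm a; rewrite -[a]reprK.
elim: (repr a) => [|[c w] s IH].
  rewrite (_ : \pi_(presented rels) [::] = scal 0) //; apply: pres_evalP => B g hg.
  by rewrite pres_eval_scal // pres_evalE // /word_eval big_nil scal0.
pose W w := foldr (fun x t => pres_gen rels x * t) 1 w.
rewrite (_ : \pi_(presented rels) _ =
             scal c * W w + \pi_(presented rels) s).
  apply: (Qa) IH; apply: (Qm) => //; elim: w => [|x w IHw] /=; first by rewrite -scal1.
  exact: Qm.
apply: pres_evalP => B g hg; have gP := pres_eval_morph hg.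
rewrite (alg_morphD gP) (alg_morphM gP) (alg_morph_scal gP) !pres_evalE // /word_eval big_cons /=.
congr (_ * _ + _); elim: w => [|x w IHw]; first by rewrite big_nil (alg_morph1 gP).
by rewrite big_cons /= (alg_morphM gP) pres_eval_gen // -IHw.
Qed.

(** * Series in the inverse of u *)

(** The coefficient of u^-k is the value at k; a separate name gives these
    functions the Cauchy product instead of the pointwise one. *)
Definition ser (A : Type) := nat -> A.

Section SeriesRing.
Variable A : pzRingType.
HB.instance Definition _ := gen_eqMixin (ser A).
HB.instance Definition _ := gen_choiceMixin (ser A).

Definition sr_zero : ser A := fun _ => 0.
Definition sr_add (a b : ser A) : ser A := fun k => a k + b k.
Definition sr_opp (a : ser A) : ser A := fun k => - a k.
Definition sr_const (x : A) : ser A := fun k => x *+ (k == 0%N).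
Definition sr_mul (a b : ser A) : ser A :=
  fun k => \sum_(r < k.+1) a r * b (k - r)%N.

Ltac sr := move=> *; apply: funext => k.
Fact sr_addA : associative sr_add. Proof. by sr; exact: addrA. Qed.
Fact sr_addC : commutative sr_add. Proof. by sr; exact: addrC. Qed.
Fact sr_add0 : left_id sr_zero sr_add. Proof. by sr; exact: add0r. Qed.
Fact sr_addN : left_inverse sr_zero sr_opp sr_add. Proof. by sr; exact: addNr. Qed.
HB.instance Definition _ :=
  GRing.isZmodule.Build (ser A) sr_addA sr_addC sr_add0 sr_addN.

Lemma sr_mul_rev a b k : sr_mul a b k = \sum_(r < k.+1) a (k - r)%N * b r.
Proof.
rewrite /sr_mul (reindex_inj rev_ord_inj) /=.
by apply: eq_bigr => j _; rewrite (sub_ordK j).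
Qed.

Fact sr_mulA : associative sr_mul.
Proof.
move=> p q r; apply: funext => i; rewrite {1}/sr_mul sr_mul_rev.
pose coef3 j k := p j * (q (i - j - k)%N * r k).
transitivity (\sum_(j < i.+1) \sum_(k < i.+1 | (k <= i - j)%N) coef3 j k).
  apply: eq_bigr => /= j _; rewrite sr_mul_rev big_distrr /=.
  by rewrite (big_ord_narrow_leq (leq_subr _ _)).
rewrite (exchange_big_dep predT) //=; apply: eq_bigr => k _.
transitivity (\sum_(j < i.+1 | (j <= i - k)%N) coef3 j k).
  apply: eq_bigl => j; rewrite -ltnS -(ltnS j) -!subSn ?leq_ord //.
  by rewrite -subn_gt0 -(subn_gt0 j) -!subnDA addnC.
rewrite (big_ord_narrow_leq (leq_subr _ _)) /sr_mul big_distrl /=.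
by apply: eq_bigr => j _; rewrite /coef3 -!subnDA addnC mulrA.
Qed.

Fact sr_mul1 : left_id (sr_const 1) sr_mul.
Proof.
move=> a; apply: funext => k; rewrite /sr_mul big_ord_recl subn0 mul1r big1 ?addr0 //.
by move=> i _; rewrite mul0r.
Qed.
Fact sr_mulr1 : right_id (sr_const 1) sr_mul.
Proof.
move=> a; apply: funext => k; rewrite sr_mul_rev big_ord_recl subn0 mulr1 big1 ?addr0 //.
by move=> i _; rewrite mulr0.
Qed.
Fact sr_mulDl : left_distributive sr_mul +%R.
Proof.
move=> x y z; apply: funext => k.
rewrite -[RHS]/(sr_mul x z k + sr_mul y z k) -big_split.
by apply: eq_bigr => i _ /=; rewrite -mulrDl.
Qed.
Fact sr_mulDr : right_distributive sr_mul +%R.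
Proof.
move=> x y z; apply: funext => k.
rewrite -[RHS]/(sr_mul x y k + sr_mul x z k) -big_split.
by apply: eq_bigr => i _ /=; rewrite -mulrDr.
Qed.
HB.instance Definition _ := GRing.Zmodule_isPzRing.Build (ser A)
  sr_mulA sr_mul1 sr_mulr1 sr_mulDl sr_mulDr.

Lemma srD (a b : ser A) k : (a + b) k = a k + b k. Proof. by []. Qed.
Lemma srN (a : ser A) k : (- a) k = - a k. Proof. by []. Qed.
Lemma sr0 k : (0 : ser A) k = 0. Proof. by []. Qed.
Lemma sr1 k : (1 : ser A) k = (k == 0%N)%:R. Proof. by []. Qed.
Lemma srM (a b : ser A) k : (a * b) k = \sum_(r < k.+1) a r * b (k - r)%N.
Proof. by []. Qed.
Lemma sr_sum I (r : seq I) (P : pred I) (F : I -> ser A) k :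
  (\sum_(i <- r | P i) F i) k = \sum_(i <- r | P i) F i k.
Proof. exact: (big_morph (fun a : ser A => a k) (fun a b => srD a b k) (sr0 k)). Qed.

Lemma sr_constMl x (a : ser A) k : (sr_const x * a) k = x * a k.
Proof.
rewrite srM big_ord_recl subn0 big1 ?addr0 //.
by move=> i _; rewrite mul0r.
Qed.
Lemma sr_constMr x (a : ser A) k : (a * sr_const x) k = a k * x.
Proof.
rewrite [LHS]sr_mul_rev big_ord_recl subn0 big1 ?addr0 //.
by move=> i _; rewrite mulr0.
Qed.

Fact sr_const_additive : zmod_morphism sr_const.
Proof. by move=> x y; apply: funext => k; rewrite /sr_const mulrnBl. Qed.
HB.instance Definition _ := GRing.isZmodMorphism.Build A (ser A) sr_const sr_const_additive.
Fact sr_const_monoid : monoid_morphism sr_const.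
Proof.
split=> // x y; apply: funext => k; rewrite sr_constMl /sr_const.
by case: (k == 0%N); rewrite ?mulr0.
Qed.
HB.instance Definition _ := GRing.isMonoidMorphism.Build A (ser A) sr_const sr_const_monoid.

(** Multiplication by 1/u. *)
Definition shift (a : ser A) : ser A := fun k => if k is k'.+1 then a k' else 0.

Lemma shiftE a : shift a = shift 1 * a.
Proof.
apply: funext => -[|k]; rewrite srM big_ord_recl /= mul0r add0r; first by rewrite big_ord0.
rewrite big_ord_recl /= mul1r subSS subn0 big1 ?addr0 //.
by move=> i _; rewrite /bump /= mul0r.
Qed.
Lemma shiftM a b : shift a * b = shift (a * b).
Proof. by rewrite shiftE [RHS]shiftE mulrA. Qed.
Lemma shift_comm a : shift a = a * shift 1.
Proof.
apply: funext => -[|k]; rewrite [RHS]sr_mul_rev big_ord_recl /= mulr0 add0r.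
  by rewrite big_ord0.
rewrite big_ord_recl /= mulr1 subSS subn0 big1 ?addr0 //.
by move=> i _; rewrite /bump /= mulr0.
Qed.

Lemma ser_regular (d a : ser A) : d 0%N = 1 -> d * a = 0 -> a = 0.
Proof.
move=> d0 da; apply: funext => k; elim/ltn_ind: k => k IH.
have := congr1 (@^~ k) da; rewrite srM big_ord_recl subn0 d0 mul1r big1 ?addr0 //.
by move=> i _; rewrite IH ?mulr0 // ltn_subrL /= (leq_trans _ (ltn_ord i)).
Qed.
End SeriesRing.

Section CentralSeries.
Context {K : fieldType}.
Variable A : kalgType K.

Definition series_scal (s : ser K) : ser A := fun k => scal (s k).

Lemma series_scal_comm s (a : ser A) : series_scal s * a = a * series_scal s.
Proof.
apply: funext => k; rewrite srM [RHS]sr_mul_rev; apply: eq_bigr => i _.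
exact: scalC.
Qed.
Lemma series_scalD s t : series_scal (s + t) = series_scal s + series_scal t.
Proof. by apply: funext => k; rewrite /series_scal scalD. Qed.
Lemma series_scalM s t : series_scal (s * t) = series_scal s * series_scal t.
Proof.
apply: funext => k; rewrite {1}/series_scal !srM scal_sum.
by apply: eq_bigr => i _; rewrite scalM.
Qed.
Lemma series_scal1 : series_scal 1 = 1.
Proof. by apply: funext => k; rewrite /series_scal !sr1 scal_nat. Qed.
End CentralSeries.
Arguments series_scal {K} A s.

(** * Affine changes of the variable *)

Section Substitution.
Context {K : fieldType}.
Implicit Types (e c : K).

Lemma inv_affine_eq e c : e != 0 ->
  sr_const e * inv_affine e c + sr_const c * shift (inv_affine e c) = shift 1 :> ser K.
Proof.
move=> e0; apply: funext => k; rewrite srD !sr_constMl.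
case: k => [|[|k]] /=; first by rewrite !mulr0 addr0.
  by rewrite mulr1 mulr0 addr0 mulfV // sr1.
rewrite sr1 exprS mulrA mulrA; apply/eqP.
rewrite mulfV // mul1r mulrA -mulrDl; apply/eqP.
by rewrite addrC subrr mul0r.
Qed.

Variable A : kalgType K.
Implicit Types (s t : ser A).

Section Fixed.
Variables (e c : K).
Local Notation y := (inv_affine e c : ser K).
Definition sub_ser (s : ser A) : ser A := ser_subst e c s.
Local Notation sigma := sub_ser.

Lemma iter_ser_mul r k : iter r (ser_mul y) ser_one k = (y ^+ r) k.
Proof.
suff -> : iter r (ser_mul y) ser_one = y ^+ r by [].
elim: r => [|r IH]; first by rewrite expr0.
by rewrite iterS IH exprS.
Qed.

Lemma exp_inv_affine_lt r k : (k < r)%N -> (y ^+ r) k = 0.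
Proof.
elim: r k => // r IH k kr; rewrite exprS srM big_ord_recl /= mul0r add0r.
apply: big1 => i _; rewrite IH ?mulr0 // /bump /=.
by have := ltn_ord i; lia.
Qed.

Lemma substE M s k : (k < M)%N ->
  sigma s k = \sum_(r < M) scal ((y ^+ r) k) * s r.
Proof.
move=> kM; rewrite /sub_ser /ser_subst (big_ord_widen M (fun r => scal (iter r (ser_mul y) ser_one k) * s r) kM).
rewrite big_mkcond; apply: eq_bigr => r _ /=; rewrite iter_ser_mul.
by case: ltnP => // rk; rewrite exp_inv_affine_lt // scal0 mul0r.
Qed.

Lemma substD s t : sigma (s + t) = sigma s + sigma t.
Proof.
apply: funext => k; rewrite srD /sub_ser /ser_subst -big_split; apply: eq_bigr => r _.
by rewrite mulrDr.
Qed.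
Lemma subst_constl x s : sigma (sr_const x * s) = sr_const x * sigma s.
Proof.
apply: funext => k; rewrite sr_constMl /sub_ser /ser_subst mulr_sumr; apply: eq_bigr => r _.
by rewrite sr_constMl !mulrA scalC.
Qed.
Lemma subst_constr x s : sigma (s * sr_const x) = sigma s * sr_const x.
Proof.
apply: funext => k; rewrite sr_constMr /sub_ser /ser_subst mulr_suml; apply: eq_bigr => r _.
by rewrite sr_constMr mulrA.
Qed.
Lemma subst0 : sigma 0 = 0.
Proof. by apply: (addrI (sigma 0)); rewrite -substD !addr0. Qed.
Lemma subst_sum I (r : seq I) (P : pred I) (F : I -> ser A) :
  sigma (\sum_(i <- r | P i) F i) = \sum_(i <- r | P i) sigma (F i).
Proof. exact: (big_morph sigma substD subst0). Qed.
Lemma subst1 : sigma 1 = 1.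
Proof.
apply: funext => k; rewrite (@substE k.+1) // big_ord_recl expr0 !sr1 mulr1 scal_nat.
by rewrite big1 ?addr0 // => i _; rewrite sr1 mulr0.
Qed.

Lemma subst_shift s : sigma (shift s) = series_scal A y * sigma s.
Proof.
apply: funext => k; rewrite (@substE k.+2) // big_ord_recl mulr0 add0r.
transitivity (\sum_(i < k.+1)
    \sum_(r < k.+1) scal (y i) * (scal ((y ^+ r) (k - i)%N) * s r)); last first.
  rewrite srM; apply: eq_bigr => i _.
  by rewrite (@substE k.+1) ?ltnS ?leq_subr // mulr_sumr.
rewrite exchange_big; apply: eq_bigr => r _ /=.
rewrite exprS srM scal_sum mulr_suml; apply: eq_bigr => i _.
by rewrite scalM mulrA.
Qed.

(** Multiplying by e u + c clears the denominator that the substitution puts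
    in the place of u^-1. *)
Lemma subst_shift_eq s : e != 0 ->
  series_scal A (sr_const e) * sigma (shift s) + series_scal A (sr_const c) * shift (sigma (shift s)) =
  shift (sigma s).
Proof.
move=> e0; rewrite !subst_shift -shiftM mulrA mulrA -mulrDl.
have -> : shift (series_scal A y) = series_scal A (shift y).
  by apply: funext => -[|k] //=; rewrite /series_scal scal0.
rewrite -!series_scalM -series_scalD inv_affine_eq // [RHS]shiftE; congr (_ * _).
by apply: funext => -[|[|k]]; rewrite /series_scal /= ?sr1 ?scal0 ?scal1.
Qed.
End Fixed.
End Substitution.

Section MatrixSeries.
Context {K : fieldType} {A : kalgType K} {N : nat}.
Implicit Types (S T : nat -> 'M[A]_N).

(** Read as a matrix over the ring of series, a series of matrices obeys the
    identities of matrix algebra. *)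
Definition mser (N' N : nat) (S : nat -> 'M[A]_(N', N)) : 'M[ser A]_(N', N) :=
  \matrix_(i, j) ((fun k => S k i j) : ser A).

Lemma mserM S T : mser (smx_mul S T) = mser S *m mser T.
Proof.
apply/matrixP=> i j; rewrite !mxE; apply: funext => k.
rewrite sr_sum /smx_mul summxE.
transitivity (\sum_(r < k.+1) \sum_q S r i q * T (k - r)%N q j).
  by apply: eq_bigr => r _; rewrite mxE.
by rewrite exchange_big; apply: eq_bigr => q _ /=; rewrite !mxE.
Qed.

Lemma mser1 : mser (@smx_one A N) = 1%:M.
Proof.
apply/matrixP=> i j; rewrite !mxE; apply: funext => -[|k] /=.
  by rewrite !mxE; case: (i == j).
by rewrite !mxE; case: (i == j).
Qed.

Lemma mser_inverse S T : smx_inverse S T ->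
  mser S *m mser T = 1%:M /\ mser T *m mser S = 1%:M.
Proof. by case=> /funext h /funext h'; rewrite -!mserM h h' mser1. Qed.
End MatrixSeries.

(** * The corner of an inverse *)

Lemma central_scalemxAr (B : pzRingType) a b e (c : B) (M : 'M[B]_(a, b)) (M' : 'M[B]_(b, e)) :
  (forall x, c * x = x * c) -> M *m (c *: M') = c *: (M *m M').
Proof.
move=> cC; apply/matrixP=> i j; rewrite !mxE mulr_sumr; apply: eq_bigr => k _.
by rewrite !mxE mulrA -cC mulrA.
Qed.

(** Push-through identity behind the comparison of the two actions.  If
    T is d' / (d + z P Q), with P and Q split along n + l, then solving for
    z (Q T) in the lower rows of the equation gives z Q T = d X Qn Tnn, where
    X is z / (d + z Ql Pl); the upper rows then exhibit the inverse
    of the corner Tnn as (d / d') (1 + Pn X Qn).  Entries need not commute. *)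
Lemma corner_inverse (B : pzRingType) (n l p : nat) (d d' f z : B)
    (T : 'M[B]_(n + l)) (Pn : 'M[B]_(n, p)) (Pl : 'M[B]_(l, p))
    (Qn : 'M[B]_(p, n)) (Ql : 'M[B]_(p, l)) (X : 'M[B]_p) (G : 'M[B]_n) :
  (forall a, d * a = a * d) -> (forall a, f * a = a * f) ->
  (forall a, z * a = a * z) ->
  (forall a, d' * a = 0 -> a = 0) -> d = d' * f ->
  d *: T + z *: (col_mx Pn Pl *m (row_mx Qn Ql *m T)) = d'%:M ->
  X *m (d%:M + z *: (Ql *m Pl)) = z%:M ->
  ulsubmx T *m G = 1%:M ->
  G = f *: (1%:M + Pn *m X *m Qn).
Proof.
move=> dC fC zC d'reg df eqT eqX TG.
pose cent := @central_scalemxAr B.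
set Tnn := ulsubmx T in TG *; pose Tln := dlsubmx T.
pose Y := Qn *m Tnn + Ql *m Tln.
have [eqN eqL] : d *: Tnn + z *: (Pn *m Y) = d'%:M /\ d *: Tln + z *: (Pl *m Y) = 0.
  move: eqT; rewrite -[T]submxK -/Tnn -/Tln mul_row_block -/Y mul_col_row.
  by rewrite !scale_block_mx add_block_mx scalar_mx_block => /eq_block_mx[].
have zY : z *: Y = d *: (X *m (Qn *m Tnn)).
  have : (d%:M + z *: (Ql *m Pl)) *m Y = d *: (Qn *m Tnn).
    rewrite mulmxDl -scalemxAl -mulmxA mul_scalar_mx {1}/Y scalerDr -addrA.
    rewrite -(cent _ _ _ _ Ql) // -(cent _ _ _ _ Ql (Pl *m Y)) // -mulmxDr.
    by rewrite eqL mulmx0 addr0.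
  move/(congr1 (mulmx X)); rewrite mulmxA eqX mul_scalar_mx => ->.
  exact: cent.
have eqF : f *: ((1%:M + Pn *m X *m Qn) *m Tnn) = 1%:M.
  apply/eqP; rewrite -subr_eq0; apply/eqP/matrixP=> i j; rewrite [RHS]mxE.
  apply: d'reg; move/matrixP/(_ i j): eqN.
  rewrite -(cent _ _ _ z) // zY (cent _ _ _ d) // -scalerDr mulmxDl mul1mx -!mulmxA.
  rewrite df -scalerA => e; rewrite mxE [X in _ * (_ + X)]mxE mulrDr mulrN.
  move: e; rewrite mxE => ->; rewrite !mxE.
  by rewrite mulr_natr subrr.
by rewrite -[LHS]mul1mx -[X in X *m G]eqF -scalemxAl -mulmxA TG mulmx1.
Qed.

(** * Differential operators *)

Section Weyl.
Context {K : fieldType} {k : nat}.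
Implicit Types (D E : PD K k) (p : {mpoly K[k]}).

Lemma pdDE D E p : (D + E) p = D p + E p. Proof. by []. Qed.
Lemma pdME D E p : (D * E) p = D (E p). Proof. by []. Qed.
Lemma pdSE c p : (scal c : PD K k) p = c *: p. Proof. by []. Qed.
Lemma pdNE D p : (- D) p = - D p. Proof. by rewrite -scaleN1r. Qed.
Lemma pd0E p : (0 : PD K k) p = 0. Proof. by rewrite -(scale0r p). Qed.
Lemma pd_sumE I (r : seq I) (P : pred I) (F : I -> PD K k) p :
  (\sum_(i <- r | P i) F i) p = \sum_(i <- r | P i) F i p.
Proof. exact: (big_morph (fun D => D p) (fun D E => pdDE D E p) (pd0E p)). Qed.
Lemma pdD D : {morph (D : {mpoly K[k]} -> {mpoly K[k]}) : p q / p + q}.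
Proof. by move=> p q; have := pd_linear D 1 p q; rewrite !scale1r. Qed.
Lemma pd0 D : D 0 = 0.
Proof. by apply: (addrI (D 0)); rewrite -pdD !addr0. Qed.
Lemma pdZ D c p : D (c *: p) = c *: D p.
Proof. by have := pd_linear D c p 0; rewrite pd0 !addr0. Qed.
Lemma pd_sum D I (r : seq I) (P : pred I) (F : I -> {mpoly K[k]}) :
  D (\sum_(i <- r | P i) F i) = \sum_(i <- r | P i) D (F i).
Proof. exact: (big_morph D (pdD D) (pd0 D)). Qed.

Lemma mderivXU (i j : 'I_k) : mderiv i ('X_j : {mpoly K[k]}) = (i == j)%:R.
Proof.
rewrite mderivX mnm1E eq_sym; case: eqP => [->|_]; last by rewrite scale0r.
rewrite scale1r (_ : (_ - _)%MM = 0%MM) ?mpolyX0 //.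
by apply/mnmP => s; rewrite !mnmE subnn.
Qed.

Lemma weyl (i j : 'I_k) p : mderiv i ('X_j * p) = 'X_j * mderiv i p + (i == j)%:R *: p.
Proof.
rewrite mderivM mderivXU addrC; congr (_ + _).
by case: (i == j); rewrite ?mul1r ?scale1r ?mul0r ?scale0r.
Qed.
Lemma mpolyX_ind (Q : {mpoly K[k]} -> Prop) :
  (forall c, Q c%:MP) -> (forall i p, Q p -> Q ('X_i * p)) ->
  (forall p q, Q p -> Q q -> Q (p + q)) -> forall p, Q p.
Proof.
move=> QC QX QD p; rewrite [p]mpolyE.
apply: (big_ind Q) => [||m _]; [by rewrite -mpolyC0|exact: QD|].
rewrite -mul_mpolyC mpolyXE_id mulrC.
have Qm (l : seq 'I_k) : Q ((\prod_(i <- l) 'X_i ^+ m i) * (p@_m)%:MP).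
  elim: l => [|i l IH]; first by rewrite big_nil mul1r.
  rewrite big_cons -mulrA; elim: (m i) => [|e IHe]; first by rewrite mul1r.
  by rewrite exprS -mulrA; exact: QX.
exact: Qm.
Qed.

Lemma mpoly_derivation_ext (f g : {mpoly K[k]} -> {mpoly K[k]}) :
  {morph f : x y / x + y} -> (forall p q, f (p * q) = f p * q + p * f q) ->
  {morph g : x y / x + y} -> (forall p q, g (p * q) = g p * q + p * g q) ->
  (forall c, f c%:MP = g c%:MP) -> (forall i, f 'X_i = g 'X_i) -> f =1 g.
Proof.
move=> fD fM gD gM fgC fgX; apply: mpolyX_ind => [//|i p h|p q h h'].
- by rewrite fM gM fgX h.
- by rewrite fD gD h h'.
Qed.
End Weyl.

(** * The form and the two commuting actions on polynomials *)

(** The properties of the standard forms that matter: theta is a sign,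
    tilde is an involution, and it flips theta in the symplectic case only. *)
Definition sign_form (K : fieldType) N (s : K) (D : formdata K N) : Prop :=
  [/\ forall i, th D i * th D i = 1, involutive (tl D)
    & forall i, th D (tl D i) = s * th D i].

Lemma std_form_sign (K : fieldType) (G : gtype) N : (G = Symp -> ~~ odd N) ->
  sign_form (pm K G) (std_form (K := K) G N).
Proof.
move=> evenN.
have tlE (i : 'I_N) : val (tl (std_form (K := K) G N) i) =
    if odd i then i.-1 else if (i.+1 < N)%N then i.+1 else i.
  rewrite /= val_insubd; have := ltn_ord i.
  by case: (odd i) => iN; case: ltnP => //=; move: iN; lia.
have tlodd (i : 'I_N) : G = Symp -> odd (tl (std_form (K := K) G N) i) = ~~ odd i.
  move/evenN => eN; have := ltn_ord i; rewrite tlE.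
  case oi: (odd i); first by move: oi; lia.
  case: (ltnP i.+1 N) => h iN; first by rewrite /= oi.
  by have E : N = i.+1 by [lia]; move: eN; rewrite {1}E /= oi.
split.
- move=> i /=; case: G {evenN tlE tlodd}; first by rewrite mulr1.
  by rewrite -exprD addnn -mul2n exprM sqrrN !expr1n.
- move=> i; apply: val_inj; rewrite !tlE; have := ltn_ord i.
  case oi: (odd i); last case: (ltnP i.+1 N) => h.
  + move=> iN; have [i0 oi'] : (0 < i)%N /\ odd i.-1 = false.
      by case: (nat_of_ord i) oi => //= j /negbTE ->.
    by rewrite oi' prednK ?iN.
  + by rewrite /= oi.
  + by move=> _; rewrite oi ltnNge h.
- move=> i; case: G tlodd {evenN tlE} => /= tlodd; first by rewrite mulr1.
  by rewrite -signr_odd tlodd // -[in RHS]signr_odd; case: (odd i); rewrite ?mulN1r ?opprK.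
Qed.

Lemma form_sum_sign (K : fieldType) n l (s : K) (D : formdata K n) (E : formdata K l) :
  sign_form s D -> sign_form s E -> sign_form s (form_sum D E).
Proof.
case=> [D1 D2 D3] [E1 E2 E3]; split=> k; case: (split_ordP k) => i -> /=.
all: by rewrite ?(unsplitK (inl _ _)) ?(unsplitK (inr _ _)) ?D1 ?D2 ?D3 ?E1 ?E2 ?E3.
Qed.

Section Dual.
Context {m : nat}.
Lemma isneg_l (i : 'I_m) : isneg (lshift m i) = true.
Proof. by rewrite /isneg /= ltn_ord. Qed.
Lemma isneg_r (i : 'I_m) : isneg (rshift m i) = false.
Proof. by rewrite /isneg /= ltnNge leq_addr. Qed.
Lemma absi_l (i : 'I_m) : absi (lshift m i) = rev_ord i.
Proof. by rewrite /absi (unsplitK (inl _ _)). Qed.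
Lemma absi_r (i : 'I_m) : absi (rshift m i) = i.
Proof. by rewrite /absi (unsplitK (inr _ _)). Qed.
End Dual.

Section HoweDuality.
Context {K : fieldType} {m N : nat} (s : K) (D : formdata K N).
Hypothesis K2 : 2%:R != 0 :> K.
Hypothesis DP : sign_form s D.
Local Notation P := (Pol K m N).
Implicit Types p : P.

Lemma eq_mxtens (a b : 'I_m) (i j : 'I_N) :
  (mxtens_index (a, i) == mxtens_index (b, j)) = (a == b) && (i == j).
Proof. by rewrite (can_eq (@mxtens_indexK m N)). Qed.

Lemma popE c i p : (pop D c i : PD K (m * N)) p =
  if isneg c then xv (absi c) i * p else - th D i *: dv (absi c) (tl D i) p.
Proof. by rewrite /pop; case: ifP. Qed.
Lemma qopE c i p : (qop D c i : PD K (m * N)) p =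
  if isneg c then dv (absi c) i p else th D i *: (xv (absi c) (tl D i) * p).
Proof. by rewrite /qop; case: ifP. Qed.

(** The action of the dual Lie algebra is N/2 - Q P: on the diagonal blocks,
    symmetrizing the products of a variable and a derivation absorbs N/2. *)
Lemma zeta_qp (a b : 'I_(m + m)) p :
  zeta D a b p =
  (N%:R / 2%:R *+ (a == b)) *: p - \sum_k (qop D a k * pop D b k : PD K (m * N)) p.
Proof.
have [thth tltl _] := DP; have tlinj := inv_inj tltl.
set h := N%:R / 2%:R; have half : h + h = N%:R by rewrite -mulr2n -[LHS]mulr_natr divfK.
rewrite /zeta; under [in RHS]eq_bigr do rewrite pdME qopE popE.
case: (split_ordP a) => a' ->; case: (split_ordP b) => b' ->;
  rewrite ?isneg_l ?isneg_r ?absi_l ?absi_r.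
- under [in RHS]eq_bigr do rewrite /dv /xv weyl eq_mxtens eqxx andbT.
  rewrite big_split /= sumr_const card_ord eq_lshift (inj_eq rev_ord_inj).
  case: eqVneq => _ /=; last by rewrite mulr0n !scale0r !add0r mul0rn addr0.
  rewrite scale1r mulr1n -scaler_nat.
  have -> : N%:R *: p = h *: p + h *: p by rewrite -scalerDl half.
  rewrite !opprD [RHS]addrCA addrC; congr (_ + _).
  by rewrite addrA subrr add0r.
- rewrite eq_lrshift mulr0n scale0r add0r -sumrN; apply: eq_bigr => k _.
  by rewrite /dv mderivZ scaleNr opprK.
- rewrite eq_rlshift mulr0n scale0r add0r; congr (- _); apply: eq_bigr => k _.
  by rewrite mulrA.
- rewrite eq_rshift; congr (_ + _); rewrite -sumrN (reindex_inj tlinj) /=.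
  apply: eq_bigr => k _.
  by rewrite -scalerAr scalerA mulrN thth scaleN1r opprK.
Qed.

(** Polarization operators; they span the image of the matrix algebra. *)
Definition polar (i j : 'I_N) : PD K (m * N) :=
  \sum_a pd_var K (mxtens_index (a, i)) * pd_der K (mxtens_index (a, j)).

Lemma polarE i j p : polar i j p = \sum_a xv a i * dv a j p.
Proof. by rewrite pd_sumE. Qed.

(** For positive c the factors of p_ci q_cj stand in the order derivation,
    variable; reordering them contributes -1 for each of the m values of c. *)
Lemma pq_polar i j :
  \sum_c pop D c i * qop D c j =
  polar i j - scal (th D i * th D j) * polar (tl D j) (tl D i) -
  scal (m%:R *+ (i == j)).
Proof.
have [thth tltl _] := DP; have tlinj := inv_inj tltl.
apply: pd_ext => p; rewrite pd_sumE big_split_ord [RHS]pdDE [in RHS]pdDE !pdNE -addrA.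
congr (_ + _).
  rewrite polarE (reindex_inj rev_ord_inj) /=; apply: eq_bigr => a _.
  by rewrite popE qopE isneg_l absi_l rev_ordK.
rewrite -opprD pdME !pdSE polarE scaler_sumr.
have -> : (m%:R *+ (i == j)) *: p = \sum_(a < m) ((i == j)%:R : K) *: p.
  by rewrite sumr_const card_ord -scaler_nat scalerA mulr_natr.
rewrite -big_split -sumrN; apply: eq_bigr => a _; rewrite [X in _ = - X]/=.
rewrite pdME popE qopE isneg_r absi_r /dv mderivZ weyl eq_mxtens eqxx (inj_eq tlinj).
rewrite scalerA mulNr scaleNr scalerDr; congr (- (_ + _)).
by case: eqVneq => [->|_]; rewrite ?thth ?scale1r // !scale0r scaler0.
Qed.
End HoweDuality.

(** * The orthogonal or symplectic Lie algebra acting by derivations *)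

Lemma linfun_eq (K : fieldType) (aT rT : vectType K) (f : aT -> rT) :
  linear f -> linfun f =1 f.
Proof.
move=> fl v; pose L : {linear aT -> rT} := HB.pack f (GRing.isLinear.Build K aT rT *:%R f fl).
exact: (lfunE L).
Qed.

Section LieAction.
Context {K : fieldType} {m N : nat}.
Local Notation P := (Pol K m N).
Implicit Types (p q : P) (A B : 'M[K]_N).

Definition dpol A : PD K (m * N) := \sum_i \sum_j scal (A i j) * polar i j.

Lemma dpolE A p : dpol A p = \sum_i \sum_j A i j *: \sum_a xv a i * dv a j p.
Proof.
rewrite pd_sumE; apply: eq_bigr => i _; rewrite pd_sumE; apply: eq_bigr => j _.
by rewrite pdME pdSE polarE.
Qed.

Lemma dpol_leibniz A p q : dpol A (p * q) = dpol A p * q + p * dpol A q.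
Proof.
rewrite !dpolE mulr_suml mulr_sumr -big_split; apply: eq_bigr => i _ /=.
rewrite mulr_suml mulr_sumr -big_split; apply: eq_bigr => j _ /=.
rewrite -scalerAl -scalerAr -scalerDr mulr_suml mulr_sumr -big_split.
congr (_ *: _); apply: eq_bigr => a _ /=.
by rewrite /dv mderivM mulrDr !mulrA; congr (_ + _); rewrite mulrAC [p * _]mulrC mulrAC.
Qed.

Lemma dpolC A c : dpol A c%:MP = 0.
Proof.
rewrite dpolE big1 // => i _; rewrite big1 // => j _.
by rewrite big1 ?scaler0 // => a _; rewrite /dv mderivC mulr0.
Qed.

Lemma dpolX A a k : dpol A (xv a k) = \sum_i A i k *: xv a i.
Proof.
rewrite dpolE; apply: eq_bigr => i _.
rewrite (bigD1 k) //= [X in _ + X]big1 ?addr0 => [|j jk]; last first.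
  rewrite big1 ?scaler0 // => b _.
  by rewrite /dv mderivXU eq_mxtens (negbTE jk) andbF mulr0.
rewrite (bigD1 a) //= big1 ?addr0 => [|b ba]; last first.
  by rewrite /dv mderivXU eq_mxtens (negbTE ba) mulr0.
by rewrite /dv mderivXU eqxx mulr1.
Qed.

Lemma dpol_linear c A B : dpol (c *: A + B) = scal c * dpol A + dpol B.
Proof.
rewrite mulr_sumr -big_split; apply: eq_bigr => i _ /=.
rewrite mulr_sumr -big_split; apply: eq_bigr => j _ /=.
by rewrite !mxE scalD scalM mulrDl mulrA.
Qed.

(** Both sides are derivations, so it suffices to compare them on variables. *)
Lemma dpol_bracket A B :
  dpol (A *m B - B *m A) = dpol A * dpol B - dpol B * dpol A.
Proof.
apply: pd_ext => p; rewrite pdDE pdNE !pdME; move: p.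
apply: mpoly_derivation_ext => [p q|p q|p q|p q|c|k].
- by rewrite pdD.
- exact: dpol_leibniz.
- by rewrite !pdD opprD addrACA.
- rewrite !dpol_leibniz !pdD !dpol_leibniz mulrBl mulrBr !opprD.
  by rewrite !addrA -!(addrA _ _ (_ * _)); ring.
- by rewrite !dpolC subrr.
- case: (mxtens_indexP k) => a j; rewrite -/(xv a j) !dpolX !pd_sum.
  under eq_bigr do rewrite !mxE scalerBl.
  rewrite sumrB; congr (_ - _).
  + under [RHS]eq_bigr do rewrite pdZ dpolX scaler_sumr.
    rewrite [RHS]exchange_big; apply: eq_bigr => i _; rewrite scaler_suml.
    by apply: eq_bigr => k' _; rewrite scalerA mulrC.
  + under [RHS]eq_bigr do rewrite pdZ dpolX scaler_sumr.
    rewrite [RHS]exchange_big; apply: eq_bigr => i _; rewrite scaler_suml.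
    by apply: eq_bigr => k' _; rewrite scalerA mulrC.
Qed.

Lemma dpol_delta i j : dpol (delta_mx i j) = polar i j.
Proof.
rewrite /dpol (bigD1 i) //= [X in _ + X]big1 ?addr0 => [|i' ne]; last first.
  by rewrite big1 // => j' _; rewrite mxE (negbTE ne) scal0 mul0r.
rewrite (bigD1 j) //= big1 ?addr0 => [|j' ne]; last first.
  by rewrite mxE (negbTE ne) andbF scal0 mul0r.
by rewrite mxE !eqxx scal1 mul1r.
Qed.

Variables (s : K) (D : formdata K N).
Hypothesis DP : sign_form s D.

Definition env_dpol : env (lie_isometry D) -> PD K (m * N) :=
  pres_eval (fun A : subvs_of (lie_isometry D) => dpol (val A)).

Lemma env_dpol_morph : alg_morph env_dpol.
Proof.
apply: pres_eval_morph; split=> [c A B|A B C ->]; last exact: dpol_bracket.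
by rewrite linearP dpol_linear.
Qed.

Lemma env_dpol_gen A : A \in lie_isometry D -> env_dpol (env_gen _ A) = dpol A.
Proof.
move=> AD; rewrite /env_dpol /env_gen pres_eval_gen; first exact: (congr1 dpol (vsprojK AD)).
by split=> [c B C|B C E ->]; [rewrite linearP dpol_linear|exact: dpol_bracket].
Qed.

Lemma Fhat_lie i j :
  delta_mx i j - (th D i * th D j) *: delta_mx (tl D j) (tl D i) \in lie_isometry D.
Proof.
have [thth tltl thtl] := DP.
have gram1 i' j' : gram D *m delta_mx i' j' = th D (tl D i') *: delta_mx (tl D i') j'.
  apply/matrixP=> a b; rewrite !mxE (bigD1 i') //= big1 ?addr0 => [|k ne]; last first.
    by rewrite !mxE (negbTE ne) mulr0.
  rewrite !mxE eqxx /= (can2_eq tltl tltl).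
  by case: eqP => [->|_]; rewrite ?tltl ?mulr1n ?mulr0n ?mul0r ?mulr0.
have gram2 i' j' : (delta_mx i' j')^T *m gram D = th D i' *: delta_mx j' (tl D i').
  apply/matrixP=> a b; rewrite !mxE (bigD1 i') //= big1 ?addr0 => [|k ne]; last first.
    by rewrite !mxE (negbTE ne) mul0r.
  rewrite !mxE eqxx /= [b == _]eq_sym.
  by case: (tl D i' == b); case: (a == j'); rewrite ?mulr1n ?mulr0n ?mul0r ?mulr0 ?mul1r ?mulr1.
rewrite memv_ker linfun_eq => [|c A B]; last first.
  by rewrite linearP mulmxDl mulmxDr -scalemxAl -scalemxAr addrACA -scalerDr.
apply/eqP.
rewrite linearB /= linearZ /= mulmxBl mulmxBr -scalemxAl -scalemxAr.
rewrite !gram1 !gram2 !tltl !scalerA !thtl.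
have -> : th D i * th D j * (s * th D j) = s * th D i * (th D j * th D j) by ring.
by rewrite -!mulrA !thth !mulr1 addrC subrKA subrr.
Qed.

Lemma env_dpol_Fhat i j :
  env_dpol (Fhat D i j) = \sum_c pop D c i * qop D c j + scal (m%:R *+ (i == j)).
Proof.
rewrite /Fhat (env_dpol_gen (Fhat_lie i j)) (pq_polar DP) subrK.
by rewrite addrC -scaleNr dpol_linear !dpol_delta scalN mulNr addrC.
Qed.
End LieAction.

(** * Splitting the variables *)

Section Substitutions.
Context {K : fieldType} {m N k : nat}.
Variable F : 'I_m -> 'I_N -> {mpoly K[k]}.
HB.instance Definition _ := GRing.RMorphism.copy (subst_vars F)
  (comp_mpoly [tuple F (mxtens_unindex j).1 (mxtens_unindex j).2 | j < m * N]).

Lemma subst_varsC c : subst_vars F c%:MP = c%:MP.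
Proof. by rewrite /subst_vars comp_mpolyC. Qed.
Lemma subst_varsX a i : subst_vars F (xv a i) = F a i.
Proof.
rewrite /subst_vars /xv comp_mpolyXU -tnth_nth tnth_mktuple.
by rewrite mxtens_indexK.
Qed.
Lemma subst_varsZ c p : subst_vars F (c *: p) = c *: subst_vars F p.
Proof. by rewrite -!mul_mpolyC rmorphM /= subst_varsC. Qed.
End Substitutions.

Section PolyInd.
Context {K : fieldType} {m N : nat}.
Local Notation P := (Pol K m N).
Lemma pol_ind (Q : P -> Prop) :
  (forall c, Q c%:MP) -> (forall a i p, Q p -> Q (xv a i * p)) ->
  (forall p q, Q p -> Q q -> Q (p + q)) -> forall p, Q p.
Proof.
move=> QC QX QD; apply: mpolyX_ind => // k p.
by case: (mxtens_indexP k) => a i; exact: QX.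
Qed.

Lemma dvXM a b i j (p : P) :
  dv a i (xv b j * p) = xv b j * dv a i p + ((a == b) && (i == j))%:R *: p.
Proof. by rewrite /dv /xv weyl eq_mxtens. Qed.
End PolyInd.

Section Renaming.
Context {K : fieldType} {m N N' : nat}.
Variable phi : 'I_N -> 'I_N'.
Hypothesis phi_inj : injective phi.

Definition rename : Pol K m N -> Pol K m N' := subst_vars (fun a i => xv a (phi i)).

Lemma rename_dv a i p : dv a (phi i) (rename p) = rename (dv a i p).
Proof.
move: p; apply: pol_ind => [c|b j p IH|p q IHp IHq].
- by rewrite /rename subst_varsC /dv !mderivC rmorph0.
- rewrite dvXM /rename rmorphM rmorphD rmorphM /= subst_varsX subst_varsZ dvXM.
  by rewrite -/rename IH (inj_eq phi_inj).
- rewrite /rename rmorphD /dv !mderivD rmorphD /=; congr (_ + _).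
    exact: IHp.
  exact: IHq.
Qed.

Lemma rename_dv0 a k p : (forall i, k != phi i) -> dv a k (rename p) = 0.
Proof.
move=> kphi; move: p; apply: pol_ind => [c|b j p IH|p q IHp IHq].
- by rewrite /rename subst_varsC /dv mderivC.
- rewrite /rename rmorphM /= subst_varsX dvXM.
  by rewrite -/rename IH (negbTE (kphi j)) andbF scale0r mulr0 add0r.
- by rewrite /rename rmorphD /dv mderivD -/rename [X in X + _]IHp [X in _ + X]IHq addr0.
Qed.
End Renaming.

Section Split.
Context {K : fieldType} (n l m : nat).
Local Notation Pn := (Pol K m n).
Local Notation Pl := (Pol K m l).
Local Notation Pnl := (Pol K m (n + l)).
Implicit Types (p : Pl) (q : Pn) (t : Pnl).

Definition mul_emb p q : Pnl := emb_l n p * emb_n l q.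

Lemma emb_lX a k : emb_l n (xv a k : Pl) = xv a (rshift n k).
Proof. exact: subst_varsX. Qed.
Lemma emb_nX a i : emb_n l (xv a i : Pn) = xv a (lshift l i).
Proof. exact: subst_varsX. Qed.

Lemma mul_emb_bilin : bilin mul_emb.
Proof.
split=> w c x y; rewrite /mul_emb /emb_l /emb_n rmorphD /= subst_varsZ.
  by rewrite mulrDl scalerAl.
by rewrite mulrDr scalerAr.
Qed.

Lemma xv_r a k p q : xv a (rshift n k) * mul_emb p q = mul_emb (xv a k * p) q.
Proof. by rewrite /mul_emb -emb_lX mulrA [in RHS]/emb_l rmorphM. Qed.
Lemma xv_l a i p q : xv a (lshift l i) * mul_emb p q = mul_emb p (xv a i * q).
Proof. by rewrite /mul_emb -emb_nX mulrCA [in RHS]/emb_n rmorphM. Qed.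
Lemma dv_r a k p q : dv a (rshift n k) (mul_emb p q) = mul_emb (dv a k p) q.
Proof.
rewrite /dv mderivM -!/(dv _ _ _) /emb_l /emb_n -!/(rename _ _).
rewrite (rename_dv (@rshift_inj n l)) (rename_dv0 (phi := @lshift n l)) ?mulr0 ?addr0 //.
by move=> i; rewrite eq_rlshift.
Qed.
Lemma dv_l a i p q : dv a (lshift l i) (mul_emb p q) = mul_emb p (dv a i q).
Proof.
rewrite /dv mderivM -!/(dv _ _ _) /emb_l /emb_n -!/(rename _ _).
rewrite (rename_dv (@lshift_inj n l)) (rename_dv0 (phi := @rshift n l)) ?mul0r ?add0r //.
by move=> k; rewrite eq_lrshift.
Qed.

Lemma mul_embZl c p q : mul_emb (c *: p) q = c *: mul_emb p q.
Proof. by rewrite /mul_emb /emb_l subst_varsZ scalerAl. Qed.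
Lemma mul_embZr c p q : mul_emb p (c *: q) = c *: mul_emb p q.
Proof. by rewrite /mul_emb /emb_n subst_varsZ scalerAr. Qed.

Variables (D : formdata K n) (E : formdata K l).

Lemma pop_r c k p q : pop (form_sum D E) c (rshift n k) (mul_emb p q) =
  mul_emb (pop E c k p) q.
Proof.
rewrite !popE; case: ifP => _; first exact: xv_r.
by rewrite mul_embZl /= (unsplitK (inr _ _)) dv_r.
Qed.
Lemma qop_r c k p q : qop (form_sum D E) c (rshift n k) (mul_emb p q) =
  mul_emb (qop E c k p) q.
Proof.
rewrite !qopE; case: ifP => _; first exact: dv_r.
by rewrite mul_embZl /= (unsplitK (inr _ _)) xv_r.
Qed.
Lemma pop_l c i p q : pop (form_sum D E) c (lshift l i) (mul_emb p q) =
  mul_emb p (pop D c i q).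
Proof.
rewrite !popE; case: ifP => _; first exact: xv_l.
by rewrite mul_embZr /= (unsplitK (inl _ _)) dv_l.
Qed.
Lemma qop_l c i p q : qop (form_sum D E) c (lshift l i) (mul_emb p q) =
  mul_emb p (qop D c i q).
Proof.
rewrite !qopE; case: ifP => _; first exact: dv_l.
by rewrite mul_embZr /= (unsplitK (inl _ _)) xv_l.
Qed.

Lemma mul_emb_suml I (r : seq I) (P : pred I) (f : I -> Pl) q :
  mul_emb (\sum_(i <- r | P i) f i) q = \sum_(i <- r | P i) mul_emb (f i) q.
Proof. by rewrite /mul_emb /emb_l rmorph_sum mulr_suml. Qed.
Lemma mul_emb_sumr I (r : seq I) (P : pred I) (f : I -> Pn) p :
  mul_emb p (\sum_(i <- r | P i) f i) = \sum_(i <- r | P i) mul_emb p (f i).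
Proof. by rewrite /mul_emb /emb_n rmorph_sum mulr_sumr. Qed.

Section Zeta.
Variable s : K.
Hypothesis K2 : 2%:R != 0 :> K.
Hypotheses (DP : sign_form s D) (EP : sign_form s E).

Lemma zeta_split a b p q :
  zeta (form_sum D E) a b (mul_emb p q) =
  mul_emb (zeta E a b p) q + mul_emb p (zeta D a b q).
Proof.
rewrite (zeta_qp K2 (form_sum_sign DP EP)) (zeta_qp K2 EP) (zeta_qp K2 DP).
have -> (x y : Pl) : mul_emb (x - y) q = mul_emb x q - mul_emb y q.
  by rewrite /mul_emb /emb_l rmorphB mulrBl.
have -> (x y : Pn) : mul_emb p (x - y) = mul_emb p x - mul_emb p y.
  by rewrite /mul_emb /emb_n rmorphB mulrBr.
rewrite mul_embZl mul_embZr mul_emb_suml mul_emb_sumr.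
rewrite natrD mulrDl mulrnDl scalerDl big_split_ord.
rewrite addrACA -opprD [X in X + _]addrC [X in _ - X]addrC.
congr (_ - (_ + _)); apply: eq_bigr => k _; rewrite !pdME.
  by rewrite pop_r qop_r.
by rewrite pop_l qop_l.
Qed.
End Zeta.

Lemma pol_act_split (h : 'M[K]_l) p q :
  pol_act (emb_gl n h) (mul_emb p q) = mul_emb (pol_act h p) q.
Proof.
rewrite /mul_emb /pol_act rmorphM /=; congr (_ * _).
  rewrite /emb_l; move: p; apply: pol_ind => [c|b j p IH|p q' IHp IHq].
  - by rewrite !subst_varsC.
  - rewrite 4!rmorphM /= IH !subst_varsX; congr (_ * _).
    rewrite big_split_ord /= big1 ?add0r => [|i _]; last by rewrite block_mxEur mxE scale0r.
    rewrite [RHS]rmorph_sum; apply: eq_bigr => i _ /=.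
    by rewrite block_mxEdr subst_varsZ subst_varsX.
  - by rewrite 4!rmorphD /= IHp IHq.
rewrite /emb_n; move: q; apply: pol_ind => [c|b j q IH|q q' IHp IHq].
- by rewrite !subst_varsC.
- rewrite 2!rmorphM /= IH !subst_varsX; congr (_ * _).
  rewrite big_split_ord /= [X in _ + X]big1 ?addr0 => [|i _]; last first.
    by rewrite block_mxEdl mxE scale0r.
  rewrite (bigD1 j) //= big1 ?addr0 => [|i ne]; last first.
    by rewrite block_mxEul mxE (negbTE ne) scale0r.
  by rewrite block_mxEul mxE eqxx scale1r.
- by rewrite 2!rmorphD /= IHp IHq.
Qed.

Lemma gram_sum : gram (form_sum D E) = block_mx (gram D) 0 0 (gram E).
Proof.
apply/matrixP=> i j; rewrite mxE.
case: (split_ordP i) => i' ->; case: (split_ordP j) => j' ->.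
all: rewrite /= ?(unsplitK (inl _ _)) ?(unsplitK (inr _ _)).
- by rewrite block_mxEul mxE eq_lshift.
- by rewrite block_mxEur mxE eq_lrshift.
- by rewrite block_mxEdl mxE eq_rlshift.
- by rewrite block_mxEdr mxE eq_rshift.
Qed.

Lemma emb_gl_isom (h : 'M[K]_l) :
  in_isom_group E h -> in_isom_group (form_sum D E) (emb_gl n h).
Proof.
rewrite /in_isom_group gram_sum /emb_gl => /eqP hE.
rewrite tr_block_mx !trmx1 !trmx0 !mulmx_block.
by rewrite !mulmx0 !mul0mx !mul1mx !mulmx1 !addr0 !add0r hE mul0mx.
Qed.

(** Pnl as the ring of polynomials in the first n columns of variables, with
    coefficients in the polynomials in the last l columns. *)
Definition split_vars : Pnl -> {mpoly {mpoly K[m * l]}[m * n]} :=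
  mmap (@mpolyC (m * n) Pl \o @mpolyC (m * l) K)
    (fun k => let ai := mxtens_unindex k in
       match split ai.2 with
       | inl i => 'X_(mxtens_index (ai.1, i))
       | inr j => (xv ai.1 j)%:MP
       end).
Definition split_coef (al : 'X_{1.. m * n}) t : Pl := (split_vars t)@_al.

Lemma split_varsC c : split_vars c%:MP = c%:MP%:MP.
Proof. by rewrite /split_vars mmapC. Qed.
Lemma split_varsX_l a i : split_vars (xv a (lshift l i)) = 'X_(mxtens_index (a, i)).
Proof. by rewrite /split_vars mmapX mmap1U mxtens_indexK /= (unsplitK (inl _ _)). Qed.
Lemma split_varsX_r a k : split_vars (xv a (rshift n k)) = (xv a k)%:MP.
Proof. by rewrite /split_vars mmapX mmap1U mxtens_indexK /= (unsplitK (inr _ _)). Qed.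
HB.instance Definition _ := GRing.RMorphism.copy split_vars
  (mmap (@mpolyC (m * n) Pl \o @mpolyC (m * l) K)
    (fun k => let ai := mxtens_unindex k in
       match split ai.2 with
       | inl i => 'X_(mxtens_index (ai.1, i))
       | inr j => (xv ai.1 j)%:MP
       end)).

Lemma split_coefD al t t' : split_coef al (t + t') = split_coef al t + split_coef al t'.
Proof. by rewrite /split_coef rmorphD mcoeffD. Qed.
Lemma split_coefZ al c t : split_coef al (c *: t) = c *: split_coef al t.
Proof.
by rewrite /split_coef -mul_mpolyC rmorphM /= split_varsC mcoeffCM mul_mpolyC.
Qed.
Lemma split_coef_sum al I (r : seq I) (P : pred I) (f : I -> Pnl) :
  split_coef al (\sum_(i <- r | P i) f i) = \sum_(i <- r | P i) split_coef al (f i).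
Proof. by rewrite /split_coef rmorph_sum raddf_sum. Qed.

Lemma split_coef_mul al p q : split_coef al (mul_emb p q) = q@_al *: p.
Proof.
rewrite /split_coef /mul_emb rmorphM /=.
have -> : split_vars (emb_l n p) = p%:MP.
  move: p; apply: pol_ind => [c|b j p IH|p p' IHp IHq].
  - by rewrite /emb_l subst_varsC split_varsC.
  - by rewrite /emb_l rmorphM rmorphM /= IH subst_varsX split_varsX_r -rmorphM.
  - by rewrite /emb_l rmorphD rmorphD /= IHp IHq -rmorphD.
have -> : split_vars (emb_n l q) = map_mpoly (@mpolyC (m * l) K) q.
  move: q; apply: pol_ind => [c|b j q IH|q q' IHp IHq].
  - by rewrite /emb_n subst_varsC split_varsC map_mpolyC.
  - by rewrite /emb_n rmorphM rmorphM /= IH rmorphM subst_varsX split_varsX_l /= /xv map_mpolyX.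
  - rewrite /emb_n rmorphD rmorphD /= IHp IHq.
    exact: (esym (rmorphD (map_mpoly (@mpolyC (m * l) K)) q q')).
by rewrite mcoeffCM mcoeff_map_mpoly mulrC mul_mpolyC.
Qed.

Lemma split_recover t :
  t = \sum_(al <- msupp (split_vars t)) mul_emb (split_coef al t) 'X_[al].
Proof.
pose bf : {rmorphism Pl -> Pnl} := subst_vars (fun a i => xv a (rshift n i)).
pose bh (k : 'I_(m * n)) : Pnl :=
  let ai := mxtens_unindex k in xv ai.1 (lshift l ai.2).
pose back u := mmap bf bh u.
have backD u v : back (u + v) = back u + back v by exact: mmapD.
have backM u v : back (u * v) = back u * back v.
  exact: (mmap_is_multiplicative bh bf).1.
transitivity (back (split_vars t)).
  move: t; apply: pol_ind => [c|b j p IH|p q IHp IHq].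
  - by rewrite split_varsC /back mmapC /= subst_varsC.
  - rewrite (rmorphM split_vars) backM; apply: (f_equal2 *%R) IH.
    case: (split_ordP j) => i -> /=.
      by rewrite split_varsX_l /back mmapX mmap1U /bh mxtens_indexK.
    by rewrite split_varsX_r /back mmapC /= subst_varsX.
  - by rewrite (rmorphD split_vars) backD; apply: (f_equal2 +%R) IHp IHq.
rewrite /back /mmap; apply: eq_bigr => al _; congr (_ * _).
rewrite mpolyXE_id /emb_n rmorph_prod; apply: eq_bigr => k _.
rewrite rmorphXn /bh; congr (_ ^+ _); case: (mxtens_indexP k) => a i.
by rewrite mxtens_indexK -emb_nX.
Qed.

(** The group acts on the last l columns only, hence on coefficients. *)
Lemma split_coef_act (h : 'M[K]_l) al t :
  split_coef al (pol_act (emb_gl n h) t) = pol_act h (split_coef al t).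
Proof.
rewrite [in LHS](split_recover t) [in RHS](split_recover t) /pol_act.
rewrite rmorph_sum !split_coef_sum rmorph_sum; apply: eq_bigr => be _ /=.
by rewrite -/(pol_act _ _) pol_act_split !split_coef_mul subst_varsZ.
Qed.
End Split.

(** * Differentiating the group action *)

Section Differential.
Context {K : fieldType} {m N : nat}.
Local Notation P := (Pol K m N).

Definition tangent (A : 'M[K]_N) (p : {mpoly K[N * N]}) : K :=
  \sum_i \sum_j A i j * mx_eval (mderiv (mxtens_index (i, j)) p) 1%:M.

Lemma mx_evalX i j (g : 'M[K]_N) : mx_eval 'X_(mxtens_index (i, j)) g = g i j.
Proof. by rewrite /mx_eval mevalXU mxtens_indexK. Qed.

Lemma tangentD A p p' : tangent A (p + p') = tangent A p + tangent A p'.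
Proof.
rewrite /tangent -big_split; apply: eq_bigr => i _; rewrite -big_split.
by apply: eq_bigr => j _ /=; rewrite mderivD /mx_eval mevalD mulrDr.
Qed.

Lemma tangent0 A : tangent A 0 = 0.
Proof. by apply: (addrI (tangent A 0)); rewrite -tangentD !addr0. Qed.

Lemma tangentXM A i j p : tangent A ('X_(mxtens_index (i, j)) * p) =
  A i j * mx_eval p 1%:M + (i == j)%:R * tangent A p.
Proof.
rewrite /tangent; under eq_bigr => i' _.
  under eq_bigr => j' _.
    rewrite mderivM mderivXU /mx_eval mevalD !mevalM -!/(mx_eval _ _) mx_evalX mulrDr.
    rewrite (_ : mx_eval (_)%:R _ = ((mxtens_index (i', j') == mxtens_index (i, j))%:R)); last first.
      by case: (_ == _); rewrite /mx_eval ?meval1 ?meval0.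
    rewrite mxE mulrCA [X in _ + X]mulrCA.
    over.
  rewrite big_split /= -mulr_sumr; over.
rewrite big_split /= -mulr_sumr; congr (_ + _ * _).
rewrite (bigD1 i) //= [X in _ + X]big1 ?addr0 => [|i' ne]; last first.
  by rewrite big1 // => j' _; rewrite eq_mxtens (negbTE ne) mul0r.
rewrite (bigD1 j) //= big1 ?addr0 => [|j' ne]; last first.
  by rewrite eq_mxtens (negbTE ne) andbF mul0r.
by rewrite eqxx mul1r.
Qed.

Lemma pol_act1 (q : P) : pol_act 1%:M q = q.
Proof.
move: q; apply: pol_ind => [c|a j q IH|q q' IHq IHq'].
- exact: subst_varsC.
- rewrite /pol_act rmorphM /= subst_varsX -/(pol_act _ q) IH; congr (_ * _).
  rewrite (bigD1 j) //= big1 ?addr0 => [|i ne]; last by rewrite mxE (negbTE ne) scale0r.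
  by rewrite mxE eqxx scale1r.
- by rewrite /pol_act rmorphD /= -!/(pol_act _ _) IHq IHq'.
Qed.

(** Matrix coefficients of the polynomial action are polynomial in the matrix,
    with the polarization operators as derivative at the identity.  Proving
    this for all functionals at once makes the induction close up: multiplying
    the argument by a variable replaces a functional by its composites with
    multiplications. *)
Lemma pol_act_tangent (q : P) (ell : P -> K^o) : linear ell ->
  exists p : {mpoly K[N * N]},
    (forall g, ell (pol_act g q) = mx_eval p g) /\
    (forall A, tangent A p = ell (dpol A q)).
Proof.
move: ell; move: q; apply: pol_ind => [c|a j q IH|q q' IHq IHq'] ell ellP.
all: have ellD x y : ell (x + y) = ell x + ell y
  by have := ellP 1 x y; rewrite !scale1r.
all: have ell0 : ell 0 = 0 by apply: (addrI (ell 0)); rewrite -ellD !addr0.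
all: have ellZ e x : ell (e *: x) = e * ell x
  by have := ellP e x 0; rewrite ell0 !addr0.
- exists (ell c%:MP)%:MP; split=> [g|A].
    by rewrite /pol_act subst_varsC /mx_eval mevalC.
  rewrite dpolC ell0 /tangent big1 // => i _; rewrite big1 // => k _.
  by rewrite mderivC /mx_eval meval0 mulr0.
- have ell_sum (F : 'I_N -> P) : ell (\sum_i F i) = \sum_i ell (F i).
    exact: (big_morph ell ellD ell0).
  have IHi i : exists p : {mpoly K[N * N]},
      (forall g, ell (xv a i * pol_act g q) = mx_eval p g) /\
      (forall A, tangent A p = ell (xv a i * dpol A q)).
    by apply: (IH (fun x => ell (xv a i * x))) => c x y; rewrite mulrDr -scalerAr ellP.
  case/choice: IHi => p pP.
  exists (\sum_i 'X_(mxtens_index (i, j)) * p i); split=> [g|A].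
    rewrite /pol_act rmorphM /= subst_varsX -/(pol_act g q) mulr_suml ell_sum.
    rewrite /mx_eval raddf_sum; apply: eq_bigr => i _ /=.
    rewrite mevalM -!/(mx_eval _ _) mx_evalX -scalerAl ellZ.
    by rewrite (pP i).1.
  rewrite (big_morph (tangent A) (tangentD A) (tangent0 A)).
  rewrite dpol_leibniz dpolX ellD mulr_suml ell_sum.
  under eq_bigr do rewrite tangentXM.
  rewrite big_split /=; congr (_ + _).
    apply: eq_bigr => i _; rewrite -scalerAl ellZ; congr (_ * _).
    by rewrite -(pP i).1 pol_act1.
  rewrite (bigD1 j) //= big1 ?addr0 => [|i ne]; last by rewrite (negbTE ne) mul0r.
  by rewrite eqxx mul1r (pP j).2.
- have [p [p1 p2]] := IHq _ ellP; have [p' [p1' p2']] := IHq' _ ellP.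
  exists (p + p'); split=> [g|A].
    by rewrite /pol_act rmorphD /= ellD p1 p1' /mx_eval mevalD.
  by rewrite tangentD p2 p2' pdD ellD.
Qed.

Variables (s : K) (D : formdata K N).
Hypothesis DP : sign_form s D.
Variables (W : vectType K) (rho : 'M[K]_N -> 'End(W)).
Variable act : env (lie_isometry D) -> W -> W.
Hypothesis actP : is_differential rho act.

(** The differential is tested against functionals; the coefficients of h give
    enough of them to compare polynomials. *)
Lemma differential_pol_act (h : W -> P) : linear h ->
  (forall g, in_isom_group D g -> forall w, h (rho g w) = pol_act g (h w)) ->
  forall x w, h (act x w) = env_dpol x (h w).
Proof.
move=> hl hrho; have [[a_lin aD aS aM] diff] := actP.
have hD x y : h (x + y) = h x + h y by have := hl 1 x y; rewrite !scale1r.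
have h0 : h 0 = 0 by apply: (addrI (h 0)); rewrite -hD !addr0.
have hZ e x : h (e *: x) = e *: h x by have := hl e x 0; rewrite h0 !addr0.
have ZP := @env_dpol_morph K m N D.
apply: presented_ind => [c|A|a b IHa IHb|a b IHa IHb] w.
- by rewrite aS (alg_morph_scal ZP) hZ.
- have -> : pres_gen _ A = env_gen (lie_isometry D) (val A).
    by rewrite /env_gen; congr pres_gen; rewrite vsvalK.
  rewrite env_dpol_gen; last exact: subvsP.
  apply/mpolyP=> al.
  pose f0 w' : K^o := (h w')@_al.
  have f0l : linear f0 by move=> c x y; rewrite /f0 hl mcoeffD mcoeffZ.
  pose f : 'Hom(W, K^o) := linfun f0.
  have fE : f =1 f0 := linfun_eq f0l.
  have [p [p1 p2]] := @pol_act_tangent (h w) (fun q => q@_al : K^o)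
    (fun c x y => etrans (mcoeffD _ _ _) (congr1 (+%R^~ _) (mcoeffZ _ _ _))).
  have fp : represents D rho p f w.
    by move=> g gD; rewrite fE /f0 hrho // p1.
  by have := diff A f w p fp; rewrite fE /f0 => ->; rewrite -p2.
- by rewrite aD (alg_morphD ZP) hD IHa IHb.
- by rewrite aM (alg_morphM ZP) IHa IHb.
Qed.
End Differential.

(** * Equivariant maps as tensors *)

Lemma big_uniq_sub (V : zmodType) (T : eqType) (r S : seq T) (F : T -> V) :
  uniq r -> uniq S -> {subset r <= S} -> (forall x, x \notin r -> F x = 0) ->
  \sum_(x <- S) F x = \sum_(x <- r) F x.
Proof.
move=> ur uS rS F0; rewrite (bigID (mem r)) /= [X in _ + X]big1 ?addr0 => [|x /F0 //].
rewrite -big_filter; apply: perm_big; apply: uniq_perm => //; first exact: filter_uniq.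
by move=> x; rewrite mem_filter /= andb_idr // => /rS.
Qed.

Section LinearFacts.
Context {K : fieldType} {V W : lmodType K}.
Variable f : V -> W.
Hypothesis fl : linear f.
Lemma linearD_of x y : f (x + y) = f x + f y.
Proof. by have := fl 1 x y; rewrite !scale1r. Qed.
Lemma linear0_of : f 0 = 0. Proof. by apply: (addrI (f 0)); rewrite -linearD_of !addr0. Qed.
Lemma linearZ_of c x : f (c *: x) = c *: f x.
Proof. by have := fl c x 0; rewrite linear0_of !addr0. Qed.
Lemma linearN_of x : f (- x) = - f x. Proof. by rewrite -scaleN1r linearZ_of scaleN1r. Qed.
Lemma linear_sum_of I (r : seq I) (P : pred I) (F : I -> V) :
  f (\sum_(i <- r | P i) F i) = \sum_(i <- r | P i) f (F i).
Proof. exact: (big_morph f linearD_of linear0_of). Qed.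
End LinearFacts.

Section TensorFacts.
Context {K : fieldType} {V W : lmodType K}.

Lemma tensor_repr (t : V ⊗ W) : t = \sum_(vw <- repr t) vw.1 ⊗ vw.2.
Proof.
apply: tens_liftP => U f hf.
rewrite (linear_sum_of (tens_lift_linear hf)) /tens_lift {1}/pairing.
by apply: eq_bigr => vw _; rewrite -[RHS]/(tens_lift f _) tens_lift_tens.
Qed.

Lemma tensor_ind (Q : V ⊗ W -> Prop) :
  (forall v w, Q (v ⊗ w)) -> Q 0 -> (forall s t, Q s -> Q t -> Q (s + t)) ->
  forall t, Q t.
Proof.
move=> Qt Q0 QD t; rewrite [t]tensor_repr.
by apply: (big_ind Q) => // vw _; exact: Qt.
Qed.

Lemma tensDl (v v' : V) (w : W) : (v + v') ⊗ w = v ⊗ w + v' ⊗ w.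
Proof. exact: (linearD_of ((tens_bilin V W).1 w)). Qed.
Lemma tensZl c (v : V) (w : W) : (c *: v) ⊗ w = c *: (v ⊗ w).
Proof. exact: (linearZ_of ((tens_bilin V W).1 w)). Qed.
Lemma tensZr c (v : V) (w : W) : v ⊗ (c *: w) = c *: (v ⊗ w).
Proof. exact: (linearZ_of ((tens_bilin V W).2 v)). Qed.
Lemma tens0l (w : W) : (0 : V) ⊗ w = 0.
Proof. exact: (linear0_of ((tens_bilin V W).1 w)). Qed.
Lemma tens_suml I (r : seq I) (P : pred I) (F : I -> V) (w : W) :
  (\sum_(i <- r | P i) F i) ⊗ w = \sum_(i <- r | P i) (F i ⊗ w).
Proof. exact: (linear_sum_of ((tens_bilin V W).1 w)). Qed.
Lemma tens_sumr I (r : seq I) (P : pred I) (v : V) (F : I -> W) :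
  v ⊗ (\sum_(i <- r | P i) F i) = \sum_(i <- r | P i) (v ⊗ F i).
Proof. exact: (linear_sum_of ((tens_bilin V W).2 v)). Qed.
End TensorFacts.

Lemma tens_map_tens (K : fieldType) (V V' W W' : lmodType K) (f : V -> V')
    (g : W -> W') v w : linear f -> linear g -> tens_map f g (v ⊗ w) = f v ⊗ g w.
Proof.
move=> fl gl; rewrite /tens_map tens_lift_tens //.
by split=> z c x y; rewrite ?fl ?gl; [rewrite tensDl tensZl|exact: (tens_bilin _ _).2].
Qed.

Section Theta.
Context {K : fieldType} (G : gtype) (n l m : nat).
Local Notation Pn := (Pol K m n).
Local Notation Pl := (Pol K m l).
Local Notation Pnl := (Pol K m (n + l)).
Variables (Wmu : vectType K) (rmu : 'M[K]_l -> 'End(Wmu)) (Lmu : lmodType K).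
Variable hmu : Lmu -> Wmu -> Pl.
Hypothesis hmuP : is_hom_space (gl_hom G rmu (fun h => pol_act h)) hmu.

(** The identification of the homomorphism spaces is pointwise: phi and psi
    correspond when hlam (psi w) v is theta w (phi v). *)
Definition theta (w : Wmu) : Lmu ⊗ Pn -> Pnl :=
  tens_lift (fun u p => emb_l n (hmu u w) * emb_n l p).

Lemma hmu_linl w : linear (hmu^~ w). Proof. by case: hmuP => h _ _ _; exact: h. Qed.
Lemma hmu_linr u : linear (hmu u).
Proof. by case: hmuP => _ _ h _; case: (h u). Qed.

Lemma theta_bilin w : bilin (fun u (p : Pn) => mul_emb (hmu u w) p).
Proof.
split=> z c x y; last by rewrite (mul_emb_bilin n l m).2.
by rewrite hmu_linl (mul_emb_bilin n l m).1.
Qed.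

Lemma theta_tens w u p : theta w (u ⊗ p) = mul_emb (hmu u w) p.
Proof. exact: (tens_lift_tens (theta_bilin w)). Qed.

Lemma theta_linear w : linear (theta w).
Proof. exact: (tens_lift_linear (theta_bilin w)). Qed.

(** Coefficients of theta along monomials in the first n columns separate
    tensors, because an element of Lmu is known by its values on Wmu. *)
Lemma theta_inj t : (forall w, theta w t = 0) -> t = 0.
Proof.
move=> t0; have hinj : forall u, (forall w, hmu u w = 0) -> u = 0 by case: hmuP.
(* The exponents occurring in the second factors of a chosen representative. *)
pose S := undup (flatten [seq msupp vw.2 | vw <- repr t]).
pose U al := \sum_(vw <- repr t) vw.2@_al *: vw.1.
have -> : t = \sum_(al <- S) U al ⊗ 'X_[al].
  rewrite {1}[t]tensor_repr; under [RHS]eq_bigr do rewrite tens_suml.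
  rewrite exchange_big; apply: eq_big_seq => -[u p] /= up_t.
  rewrite {1}[p]mpolyE tens_sumr -(big_uniq_sub (S := S)) ?msupp_uniq ?undup_uniq //.
  - by apply: eq_bigr => al _; rewrite tensZl tensZr.
  - move=> al alp; rewrite mem_undup; apply/flattenP; exists (msupp p) => //.
    by apply/mapP; exists (u, p).
  - by move=> al; rewrite -mcoeff_eq0 => /eqP ->; rewrite scale0r (linear0_of ((tens_bilin _ _).2 _)).
apply: big1 => al _; rewrite (hinj (U al)) ?tens0l // => w.
have := congr1 (split_coef al) (t0 w); rewrite {1}[t]tensor_repr (linear_sum_of (theta_linear w)).
rewrite split_coef_sum (_ : split_coef al 0 = 0) => [<-|]; last first.
  by rewrite -(scale0r (0 : Pnl)) split_coefZ scale0r.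
rewrite /U (linear_sum_of (hmu_linl w)); apply: eq_bigr => -[u p] _ /=.
by rewrite theta_tens split_coef_mul (linearZ_of (hmu_linl w)).
Qed.

Lemma theta_inj2 s t : (forall w, theta w s = theta w t) -> s = t.
Proof.
move=> st; apply/eqP; rewrite -subr_eq0; apply/eqP; apply: theta_inj => w.
by rewrite (linearD_of (theta_linear w)) (linearN_of (theta_linear w)) st subrr.
Qed.

(** Conversely every equivariant family comes from a tensor: its coefficients
    are equivariant maps to Pl, hence elements of Lmu, and finitely many of them
    are nonzero since Wmu has finite dimension. *)
Lemma theta_surj (F : Wmu -> Pnl) : linear F ->
  (forall h, in_isom_group (dataL K G l) h ->
     forall w, F (rmu h w) = pol_act (emb_gl n h) (F w)) ->
  exists t, forall w, theta w t = F w.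
Proof.
move=> Fl Feq; have [_ _ _ hsurj] := hmuP.
have Flin al : linear (fun w => split_coef al (F w)).
  by move=> c x y; rewrite Fl split_coefD split_coefZ.
have /choice[u uP] al : exists u, hmu u =1 (fun w => split_coef al (F w)).
  by apply: hsurj; split=> [|h hG w]; [exact: Flin|rewrite Feq // split_coef_act].
pose b := vbasis (fullv : {vspace Wmu}).
(* Outside S the coefficients vanish on a basis of Wmu, hence everywhere. *)
pose S := undup (flatten [seq msupp (split_vars (F x)) | x <- b]).
have S0 w al : al \notin S -> split_coef al (F w) = 0.
  move=> alS; rewrite (coord_vbasis (memvf w)) (linear_sum_of (Flin al)) big1 // => i _.
  rewrite (linearZ_of (Flin al)) [X in _ *: X](_ : _ = 0) ?scaler0 //.
  apply/eqP; rewrite /split_coef mcoeff_eq0; apply: contra alS => bS.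
  rewrite mem_undup; apply/flattenP; eexists; last exact: bS.
  apply/mapP; eexists; last by [].
  by rewrite mem_nth // size_tuple.
exists (\sum_(al <- S) u al ⊗ 'X_[al]) => w.
rewrite (linear_sum_of (theta_linear w)) [RHS]split_recover.
under eq_bigr do rewrite theta_tens uP.
have S0' al : al \notin msupp (split_vars (F w)) -> split_coef al (F w) = 0.
  by rewrite -mcoeff_eq0 => /eqP.
apply: big_uniq_sub => [| |al alF|al alF]; rewrite ?msupp_uniq ?undup_uniq //.
  by apply: contraLR alF => /(S0 w) /eqP; rewrite -mcoeff_eq0.
by rewrite S0' // /mul_emb /emb_l rmorph0 mul0r.
Qed.
End Theta.

(** * The Olshanski homomorphism *)

Section SeriesMaps.
Context {K : fieldType} {A B : kalgType K}.
Variable f : A -> B.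
Hypothesis fP : alg_morph f.

Lemma alg_morph_mulmx a b c (M : 'M[A]_(a, b)) (M' : 'M[A]_(b, c)) :
  map_mx f (M *m M') = map_mx f M *m map_mx f M'.
Proof.
apply/matrixP=> i j; rewrite !mxE (alg_morph_sum fP); apply: eq_bigr => k _.
by rewrite (alg_morphM fP) !mxE.
Qed.

Lemma alg_morph_smx_inverse N (S T : nat -> 'M[A]_N) : smx_inverse S T ->
  smx_inverse (fun k => map_mx f (S k)) (fun k => map_mx f (T k)).
Proof.
have mulE (U V : nat -> 'M[A]_N) k :
    smx_mul (fun k => map_mx f (U k)) (fun k => map_mx f (V k)) k =
    map_mx f (smx_mul U V k).
  apply/matrixP=> i j; rewrite mxE !summxE (alg_morph_sum fP); apply: eq_bigr => r _.
  by rewrite -alg_morph_mulmx mxE.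
have oneE k : map_mx f (@smx_one A N k) = @smx_one B N k.
  case: k => [|k]; apply/matrixP=> i j; rewrite !mxE ?(alg_morph0 fP) //.
  by case: (i == j); rewrite ?(alg_morph1 fP) ?(alg_morph0 fP).
by case=> h h'; split=> k; rewrite mulE ?h ?h' oneE.
Qed.

Lemma alg_morph_subst e c (s : nat -> A) k :
  f (ser_subst e c s k) = ser_subst e c (fun r => f (s r)) k.
Proof.
by rewrite (alg_morph_sum fP); apply: eq_bigr => r _; rewrite (alg_morphM fP) (alg_morph_scal fP).
Qed.
End SeriesMaps.

Lemma mxaddE (B : nmodType) a b (U V : 'M[B]_(a, b)) i j : (U + V) i j = U i j + V i j.
Proof. by rewrite mxE. Qed.
Lemma mxscaleE (B : pzRingType) a b x (U : 'M[B]_(a, b)) i j : (x *: U) i j = x * U i j.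
Proof. by rewrite mxE. Qed.

Section SeriesMatrices.
Context {K : fieldType} {A : kalgType K}.

Lemma mser_subst N e c (S : nat -> 'M[A]_N) :
  mser (smx_subst e c S) = map_mx (sub_ser e c) (mser S).
Proof.
apply/matrixP=> i j; rewrite !mxE; apply: funext => k; rewrite mxE.
by rewrite /sub_ser; congr ser_subst; apply: funext => r.
Qed.

Definition const_scal (x : K) : ser A := sr_const (scal x).

Lemma const_scal_comm x (a : ser A) : const_scal x * a = a * const_scal x.
Proof. by apply: funext => k; rewrite sr_constMl sr_constMr scalC. Qed.
Lemma const_scalD x y : const_scal (x + y) = const_scal x + const_scal y.
Proof. by rewrite /const_scal scalD rmorphD. Qed.
Lemma const_scalN x : const_scal (- x) = - const_scal x.
Proof. by rewrite /const_scal scalN rmorphN. Qed.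
Lemma const_scal1 : const_scal 1 = 1. Proof. by rewrite /const_scal scal1 rmorph1. Qed.
Lemma series_scal_const x : series_scal A (sr_const x) = const_scal x.
Proof. by apply: funext => -[|k]; rewrite /series_scal /const_scal /sr_const ?mulr0n ?scal0 ?mulr1n. Qed.
Lemma shift_series_scal s : shift (series_scal A s) = series_scal A (shift s).
Proof. by apply: funext => -[|k] //=; rewrite /series_scal scal0. Qed.

Definition uinv : ser A := shift 1.
Lemma uinv_comm a : uinv * a = a * uinv.
Proof. by rewrite -shiftE shift_comm. Qed.

(** 1 + x / u *)
Definition affine x : ser A := 1 + const_scal x * uinv.
Lemma affine_comm x a : affine x * a = a * affine x.
Proof.
by rewrite mulrDl mulrDr mul1r mulr1 -!mulrA uinv_comm !mulrA const_scal_comm.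
Qed.
Lemma affine_regular x a : affine x * a = 0 -> a = 0.
Proof.
by apply: ser_regular; rewrite /affine srD sr_constMl sr1 mulr0 addr0.
Qed.

Lemma subst_uinv e c (w : ser A) : e != 0 ->
  (const_scal e + const_scal c * uinv) * sub_ser e c (shift w) = uinv * sub_ser e c w.
Proof.
move=> e0; rewrite -[RHS]shiftE -(subst_shift_eq c w e0) mulrDl !series_scal_const -mulrA.
by rewrite -[uinv * _]shiftE.
Qed.

(** The rule of substitution for an equation linear in 1/u, once denominators
    are cleared. *)
Lemma subst_linear e c (x : K) (s t r : ser A) : e != 0 ->
  s + const_scal x * shift s + shift t = r ->
  (const_scal e + const_scal (c + x) * uinv) * sub_ser e c s + uinv * sub_ser e c t =
  (const_scal e + const_scal c * uinv) * sub_ser e c r.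
Proof.
move=> e0 <-; rewrite !substD subst_constl -/(const_scal x).
rewrite !mulrDr (subst_uinv c t e0); congr (_ + _).
rewrite [X in _ = _ + X]mulrA -const_scal_comm -mulrA (subst_uinv c s e0).
by rewrite const_scalD [(const_scal c + _) * _]mulrDl [_ + (_ + _)]addrA [LHS]mulrDl mulrA.
Qed.

Lemma subst_nat e c (b : bool) : sub_ser e c (b%:R : ser A) = b%:R.
Proof. by case: b; rewrite ?subst1 ?subst0. Qed.

Lemma subst_mulmx_const a b b' e c (R : 'M[ser A]_(a, b)) (M : 'M[A]_(b, b')) i j :
  sub_ser e c ((R *m map_mx (@sr_const A) M) i j) =
  (map_mx (sub_ser e c) R *m map_mx (@sr_const A) M) i j.
Proof.
by rewrite !mxE subst_sum; apply: eq_bigr => k _; rewrite !mxE subst_constr.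
Qed.

Lemma subst_const_mulmx a b b' e c (M : 'M[A]_(a, b)) (R : 'M[ser A]_(b, b')) i j :
  sub_ser e c ((map_mx (@sr_const A) M *m R) i j) =
  (map_mx (@sr_const A) M *m map_mx (sub_ser e c) R) i j.
Proof.
by rewrite !mxE subst_sum; apply: eq_bigr => k _; rewrite !mxE subst_constl.
Qed.

Lemma const_sandwich a b p q (P : 'M[A]_(a, p)) (X : 'M[ser A]_(p, q))
    (Q : 'M[A]_(q, b)) i j k :
  (map_mx (@sr_const A) P *m X *m map_mx (@sr_const A) Q) i j k =
  \sum_c \sum_d P i c * X c d k * Q d j.
Proof.
rewrite mxE sr_sum [RHS]exchange_big; apply: eq_bigr => d _ /=.
rewrite !mxE sr_constMr sr_sum mulr_suml; apply: eq_bigr => c _.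
by rewrite !mxE sr_constMl.
Qed.

(** 1 + F / (u + d) at u := e u + c, cleared of denominators. *)
Lemma inverse_pole N e c d (F : 'M[A]_N) (B : 'M[ser A]_N) : e != 0 ->
  map_mx (sub_ser e c)
    (\matrix_(i, j) ((i == j)%:R + series_scal A (inv_affine 1 d) * sr_const (F i j))) *m B = 1%:M ->
  forall i j, (const_scal e + const_scal (c + d) * uinv) * B i j +
    uinv * (map_mx (@sr_const A) F *m B) i j = (const_scal e + const_scal (c + d) * uinv) * (i == j)%:R.
Proof.
move=> e0 /matrixP eqB i j; pose y := sub_ser e c (series_scal A (inv_affine 1 d)).
have y_eq : (const_scal e + const_scal (c + d) * uinv) * y = uinv.
  rewrite -[RHS]mulr1 -(subst1 A e c) -(subst_uinv c 1 e0).
  rewrite -(@subst_linear e c d (series_scal A (inv_affine 1 d)) 0 (shift 1)) //.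
    by rewrite subst0 mulr0 addr0.
  rewrite shift_series_scal -series_scal_const -series_scalM (_ : shift 0 = 0); last by apply: funext => -[].
  rewrite addr0 -series_scalD -(series_scal1 A) shift_series_scal -(inv_affine_eq d (oner_neq0 K)).
  by rewrite -[sr_const 1]/(1 : ser K) mul1r.
have := eqB i j; rewrite [in RHS]mxE => <-.
rewrite -[X in _ + X * _]y_eq -[y_in in _ + y_in]mulrA -mulrDr; congr (_ * _).
rewrite !mxE mulr_sumr.
rewrite [RHS](eq_bigr (fun k => (i == k)%:R * B k j + y * (map_mx (@sr_const A) F i k * B k j))).
  rewrite big_split [X in _ = X + _](bigD1 i) //= eqxx mul1r [X in _ + X + _]big1 ?addr0 // => k ne.
  by rewrite eq_sym (negbTE ne) mul0r.
by move=> k _; rewrite !mxE substD subst_constr subst_nat mulrDl mulrA.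
Qed.
(** The coefficients of (u - Phi)^-1. *)
Definition geom p (Phi : 'M[A]_p) (k : nat) : 'M[A]_p :=
  if k is k'.+1 then iter k' (mulmx Phi) 1%:M else 0.

Lemma geomS p (Phi : 'M[A]_p) k :
  geom Phi k.+1 = (if k is 0 then 1%:M else 0) + geom Phi k *m Phi.
Proof.
case: k => [|k] /=; first by rewrite mul0mx addr0.
rewrite add0r; elim: k => [|k IH] /=; first by rewrite mulmx1 mul1mx.
by rewrite -mulmxA -IH.
Qed.

(** Substitution u + c in (u - Phi)^-1 with Phi = h - M gives (u + c - h + M)^-1;
    the equation for this inverse is written divided by u. *)
Lemma geom_inverse p c h (M : 'M[A]_p) :
  map_mx (sub_ser 1 c) (mser (geom ((scal h)%:M - M))) *m
    ((affine (c - h))%:M + uinv *: map_mx (@sr_const A) M) = uinv%:M.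
Proof.
set Phi := _ - M; pose rho := mser (geom Phi); pose cM := map_mx (@sr_const A) M.
have rhoE a b : rho a b + const_scal (- h) * shift (rho a b) + shift ((rho *m cM) a b) =
    shift (a == b)%:R.
  have -> : rho *m cM = const_scal h *: rho - rho *m map_mx (@sr_const A) Phi.
    have -> : map_mx (@sr_const A) Phi = (const_scal h)%:M - cM.
      by rewrite map_mxB map_scalar_mx.
    rewrite mulmxBr opprB addrC -scalemx1 central_scalemxAr ?mulmx1 ?subrK //.
    exact: const_scal_comm.
  have shiftD (x y : ser A) : shift (x + y) = shift x + shift y.
    by apply: funext => -[|k] //=; rewrite srD addr0.
  have shiftN (x : ser A) : shift (- x) = - shift x.
    by apply: funext => -[|k] //=; rewrite srN oppr0.
  have -> (U V : 'M[ser A]_p) x : (x *: U - V) a b = x * U a b - V a b.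
    by rewrite !mxE.
  rewrite shiftD shiftN.
  rewrite const_scalN mulNr [shift (const_scal _ * _)]shiftE mulrA uinv_comm -mulrA -shiftE.
  rewrite [_ + (_ - _)]addrA subrK; apply/eqP; rewrite subr_eq; apply/eqP.
  apply: funext => -[|k]; first by rewrite srD /= addr0 !mxE.
  rewrite srD /= mxE geomS 2!mxE; congr (_ + _).
    by case: k => [|k]; rewrite mxE; case: (a == b).
  by rewrite !mxE sr_sum; apply: eq_bigr => e _; rewrite !mxE sr_constMr.
apply/matrixP=> a b; rewrite mulmxDr -[(affine _)%:M]scalemx1.
rewrite (central_scalemxAr _ _ (affine_comm _)) mulmx1 (central_scalemxAr _ _ uinv_comm).
rewrite mxaddE 2!mxscaleE -subst_mulmx_const -/cM -/rho [map_mx _ _ _ _]mxE.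
have := subst_linear c (oner_neq0 K) (rhoE a b).
rewrite subst_uinv ?oner_neq0 // subst_nat const_scal1 -/(affine _) => ->.
by rewrite mxE mulr_natr.
Qed.
End SeriesMatrices.
Arguments const_scal {K} A x.
Arguments uinv {K} A.
Arguments affine {K} A x.

Section OlshanskiSeries.
Context {K : fieldType} (G : gtype) (n l m : nat).
Hypothesis n_even : G = Symp -> ~~ odd n.
Hypothesis l_even : G = Symp -> ~~ odd l.
Local Notation DN := (dataN K G n).
Local Notation DD := (dataNL K G n l).
Local Notation A := (PD K (m * (n + l))).
Local Notation cmx := (map_mx (@sr_const A)).
Local Notation a' := ((pm K G - l%:R) / 2%:R : K).

Lemma dataNL_sign : sign_form (pm K G) DD.
Proof. by apply: form_sum_sign; apply: std_form_sign. Qed.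

Definition pmat : 'M[A]_(n + l, m + m) := \matrix_(i, c) pop DD c i.
Definition qmat : 'M[A]_(m + m, n + l) := \matrix_(c, i) qop DD c i.

Variable gamma : XYangian DN -> env (lie_isometry DD).
Hypothesis gammaP : is_olshanski gamma.

Definition gamma_mx : 'M[ser A]_n :=
  mser (fun k => map_mx (fun x => env_dpol (gamma x) : A) (Sgen DN k)).

(** The substitutions -u - (n+l)/2 and -u - n/2 made by the two automorphisms
    compose to u - l/2, so that T, the inverse of 1 + (P Q + m) / (u - (l -+ 1)/2),
    satisfies a linear equation once the denominator is cleared. *)
Lemma gamma_corner : exists T : 'M[ser A]_(n + l),
  affine A (a' + m%:R) *: T + uinv A *: (cmx pmat *m (cmx qmat *m T)) = (affine A a')%:M
  /\ ulsubmx T *m gamma_mx = 1%:M.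
Proof.
have [om [io [om' [p [[omM omI] [ioM ioE] [om'M om'I] [pM pE] gammaE]]]]] := gammaP.
pose Z : env (lie_isometry DD) -> A := env_dpol (D := DD).
have ZM : alg_morph Z := @env_dpol_morph K m (n + l) DD.
pose f := Z \o p; have fM : alg_morph f := alg_morph_comp pM ZM.
pose g := f \o om'; have gM : alg_morph g := alg_morph_comp om'M fM.
pose h := g \o io; have hM : alg_morph h := alg_morph_comp ioM gM.
pose B := mser (fun k => map_mx g (Sgen DD k)).
pose F : 'M[A]_(n + l) := \matrix_(i, j) Z (Fhat DD i j).
(* The two automorphisms replace u by e u + c1 and by e u + c2. *)
pose e : K := -1; have e0 : e != 0 by rewrite oppr_eq0 oner_neq0.
pose c1 : K := - ((n + l)%:R / 2%:R); pose c2 : K := - (n%:R / 2%:R).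
pose d : K := pm K G / 2%:R.
have substM N (D : formdata K N) c (f0 : XYangian D -> A) : alg_morph f0 ->
    (fun k => map_mx f0 (smx_subst e c (Sgen D) k)) =
    smx_subst e c (fun k => map_mx f0 (Sgen D k)).
  move=> f0M; apply: funext => k; apply/matrixP=> i j; rewrite !mxE (alg_morph_subst f0M).
  by congr ser_subst; apply: funext => r; rewrite mxE.
have eqB : map_mx (sub_ser e c1)
    (\matrix_(i, j) ((i == j)%:R + series_scal A (inv_affine 1 d) * sr_const (F i j))) *m B = 1%:M.
  have [_] := mser_inverse (alg_morph_smx_inverse fM om'I).
  rewrite (substM _ _ _ _ fM) mser_subst => <-; congr (map_mx _ _ *m _); last first.
    by apply/matrixP=> i j; rewrite !mxE; apply: funext => k; rewrite !mxE.
  apply/matrixP=> i j; rewrite !mxE; apply: funext => k; rewrite mxE /f /= pE.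
  rewrite (alg_morphD ZM) (alg_morphM ZM) !(alg_morph_scal ZM) srD sr_constMr; congr (_ + _).
  by case: (i == j); case: k => [|k]; rewrite ?sr1 ?scal1 ?scal0.
pose T := map_mx (sub_ser e c2) B. exists T.
have aE : a' = - (c2 - (c1 + d)) by rewrite /c1 /c2 /d natrD; ring.
have eqT i j : affine A a' * T i j + uinv A * (cmx F *m T) i j = affine A a' * (i == j)%:R.
  have sign x : const_scal A e + const_scal A x * uinv A = - affine A (- x).
    by rewrite /affine const_scalN mulNr opprD opprK const_scalN const_scal1.
  have := inverse_pole e0 eqB i j; rewrite sign => eqBij.
  have pole y (t : ser A) : affine A y * t = t + const_scal A y * shift t.
    by rewrite mulrDl mul1r -mulrA -shiftE.
  have eq1 : B i j + const_scal A (- (c1 + d)) * shift (B i j) + shift (- (cmx F *m B) i j) =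
      affine A (- (c1 + d)) * (i == j)%:R.
    apply: oppr_inj; rewrite -[RHS]mulNr -eqBij mulNr pole opprD; congr (_ + _).
    by rewrite shiftE mulrN opprK.
  have eq2 := subst_linear c2 e0 eq1.
  have eq3 : - affine A a' * (i == j)%:R =
      - affine A (- c2) * sub_ser e c2 (affine A (- (c1 + d)) * (i == j)%:R).
    rewrite aE -!sign -(@subst_linear _ _ e c2 (- (c1 + d)) ((i == j)%:R : ser A) 0) //.
      by rewrite subst_nat subst0 mulr0 addr0 sign.
    by rewrite pole (_ : shift 0 = 0) ?addr0 //; apply: funext => -[].
  have FT : (cmx F *m T) i j = sub_ser e c2 ((cmx F *m B) i j).
    by rewrite subst_const_mulmx.
  have substN s : sub_ser e c2 (- s) = - sub_ser e c2 s :> ser A.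
    by apply/eqP; rewrite -addr_eq0 -substD addNr subst0.
  apply: oppr_inj; rewrite opprD -[RHS]mulNr eq3 -sign -eq2 sign -aE substN -FT.
  by rewrite mulrN mulNr mxE.
split; last first.
  have [_ inv] := mser_inverse (alg_morph_smx_inverse hM omI); rewrite -inv; congr (_ *m _).
    rewrite substM // mser_subst; apply/matrixP=> i j; rewrite !mxE; congr sub_ser.
    by apply: funext => k; rewrite !mxE /h /= ioE.
  apply/matrixP=> i j; rewrite !mxE; apply: funext => k.
  by rewrite !mxE gammaE.
have FE : cmx F = cmx pmat *m cmx qmat + (const_scal A m%:R)%:M.
  rewrite -map_mxM -map_scalar_mx -map_mxD; congr map_mx; apply/matrixP=> i j.
  rewrite !mxE /Z (env_dpol_Fhat dataNL_sign); congr (_ + _).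
    by apply: eq_bigr => c _; rewrite !mxE.
  by case: (i == j); rewrite ?mulr1n ?mulr0n ?scal0.
clearbody T; apply/matrixP=> i j; have := eqT i j.
rewrite FE mulmxDl mul_scalar_mx -mulmxA; set M := _ *m (_ *m T).
rewrite !mxaddE !mxscaleE => eqij; rewrite [RHS]mxE -[RHS]mulr_natr -eqij.
rewrite mulrDr [RHS]addrCA [RHS]addrC mulrA -mulrDl; congr (_ * _ + _).
by rewrite /affine const_scalD mulrDl addrA uinv_comm.
Qed.

Local Notation Pn := (usubmx (cmx pmat)).
Local Notation Pl := (dsubmx (cmx pmat)).
Local Notation Qn := (lsubmx (cmx qmat)).
Local Notation Ql := (rsubmx (cmx qmat)).

(** The action of the dual Lie algebra on the last l columns. *)
Definition zeta_mx : 'M[A]_(m + m) :=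
  \matrix_(c, d) (scal (l%:R / 2%:R *+ (c == d)) -
                  \sum_k qop DD c (rshift n k) * pop DD d (rshift n k)).

(** The matrix (x + Ql Pl)^-1 for x = u - (l -+ 1)/2 + m. *)
Definition dual_mx : 'M[ser A]_(m + m) :=
  map_mx (sub_ser 1 (pm K G / 2%:R + m%:R)) (mser (geom zeta_mx)).

Lemma dual_mx_eq :
  dual_mx *m ((affine A (a' + m%:R))%:M + uinv A *: (Ql *m Pl)) = (uinv A)%:M.
Proof.
have -> : Ql *m Pl = cmx (rsubmx qmat *m dsubmx pmat).
  by rewrite map_mxM map_rsubmx map_dsubmx.
have -> : a' + m%:R = pm K G / 2%:R + m%:R - l%:R / 2%:R by ring.
rewrite /dual_mx (_ : zeta_mx = (scal (l%:R / 2%:R))%:M - rsubmx qmat *m dsubmx pmat).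
  exact: geom_inverse.
apply/matrixP=> c d; rewrite !mxE; congr (_ - _).
  by case: (c == d); rewrite ?mulr1n ?mulr0n ?scal0.
by apply: eq_bigr => k _; rewrite !mxE.
Qed.

Lemma f_series_affine :
  affine A (a' + m%:R) = affine A a' * series_scal A (f_series G l m : ser K).
Proof.
pose i1 : ser K := inv_affine 1 a'.
have -> : (f_series G l m : ser K) = 1 + sr_const m%:R * i1.
  apply: funext => k; rewrite srD sr_constMl sr1 /f_series.
  by rewrite (_ : - ((l%:R - pm K G) / 2%:R) = a') // -mulNr opprB.
have i1E : affine A a' * series_scal A i1 = uinv A.
  rewrite /uinv -(series_scal1 A) shift_series_scal -(inv_affine_eq a' (oner_neq0 K)).
  rewrite -[sr_const 1]/(1 : ser K) mul1r series_scalD series_scalM series_scal_const -shift_series_scal.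
  by rewrite mulrDl mul1r -mulrA -[uinv A * _]shiftE.
rewrite series_scalD series_scal1 series_scalM series_scal_const mulrDr mulr1 mulrA -const_scal_comm -mulrA i1E.
by rewrite /affine const_scalD mulrDl addrA.
Qed.

(** [corner_inverse] applied to T: after division by u, its d, d' and X are
    x / u, u' / u and (x + Ql Pl)^-1, for u' = u - (l -+ 1)/2 and x = u' + m. *)
Lemma gamma_series :
  gamma_mx = series_scal A (f_series G l m) *: (1%:M + Pn *m dual_mx *m Qn).
Proof.
have [T [eqT TG]] := gamma_corner.
rewrite -[cmx pmat]vsubmxK -[cmx qmat]hsubmxK in eqT.
exact: (corner_inverse (affine_comm (A := A) _) (series_scal_comm (A := A) _) (uinv_comm (A := A))
  (@affine_regular _ A _) f_series_affine eqT dual_mx_eq TG).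
Qed.

Lemma gamma_seriesE k i j : env_dpol (gamma (Sgen DN k i j)) =
  \sum_(r < k.+1) scal (f_series G l m r) *
    (scal (ser_one (k - r)%N *+ (i == j)) +
     \sum_c \sum_d pop DD c (lshift l i) *
       ser_subst 1 (pm K G / 2%:R + m%:R) (fun r => geom zeta_mx r c d) (k - r)%N *
       qop DD d (lshift l j)) :> A.
Proof.
transitivity ((gamma_mx i j : ser A) k); first by rewrite /gamma_mx !mxE.
rewrite gamma_series mxscaleE srM; apply: eq_bigr => r _; congr (_ * _).
rewrite mxaddE srD; congr (_ + _).
  rewrite mxE /ser_one; case: (i == j); rewrite ?mulr1n ?mulr0n ?scal0 //.
  by rewrite sr1 scal_nat.
rewrite -map_usubmx -map_lsubmx const_sandwich; apply: eq_bigr => c _.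
by apply: eq_bigr => d _; rewrite !mxE; congr (_ * _ * _).
Qed.
End OlshanskiSeries.

(** * Comparing the two actions *)

Section Actions.
Context {K : fieldType} {A : kalgType K} {V : lmodType K} {act : A -> V -> V}.
Hypothesis actP : Defs.is_action act.
Lemma actD a b v : act (a + b) v = act a v + act b v.
Proof. by case: actP. Qed.
Lemma actM a b v : act (a * b) v = act a (act b v).
Proof. by case: actP. Qed.
Lemma act_scal c v : act (scal c) v = c *: v.
Proof. by case: actP. Qed.
Lemma act_lin a : linear (act a).
Proof. by case: actP. Qed.
Lemma act0 v : act 0 v = 0.
Proof. by rewrite -(scal0 A) act_scal scale0r. Qed.
Lemma act1 v : act 1 v = v.
Proof. by have := act_scal 1 v; rewrite scal1 scale1r. Qed.
Lemma act_sum I (r : seq I) (P : pred I) (F : I -> A) v :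
  act (\sum_(i <- r | P i) F i) v = \sum_(i <- r | P i) act (F i) v.
Proof. exact: (big_morph (fun a => act a v) (fun a b => actD a b v) (act0 v)). Qed.
End Actions.

Section Comparison.
Context {K : fieldType} (G : gtype) (n l m : nat).
Hypothesis K2 : 2%:R != 0 :> K.
Hypothesis n_even : G = Symp -> ~~ odd n.
Hypothesis l_even : G = Symp -> ~~ odd l.
Variables (Wmu : vectType K) (rmu : 'M[K]_l -> 'End(Wmu)).
Variables (Lmu : lmodType K) (amu : env (fm K G m) -> Lmu -> Lmu).
Hypothesis amuP : Defs.is_action amu.
Variable hmu : Lmu -> Wmu -> Pol K m l.
Hypothesis hmuP : is_howe_mu rmu amu hmu.
Local Notation DN := (dataN K G n).
Local Notation DL := (dataL K G l).
Local Notation DD := (dataNL K G n l).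
Local Notation Theta := (@theta _ n l m _ _ hmu).
Local Notation PDnl := (PD K (m * (n + l))).

Let hom := hmuP.1.

Lemma DN_sign : sign_form (pm K G) DN. Proof. exact: std_form_sign. Qed.
Lemma DL_sign : sign_form (pm K G) DL. Proof. exact: std_form_sign. Qed.

Lemma zeta_linear N s (D : formdata K N) a b : sign_form s D ->
  linear (zeta D a b : Pol K m N -> Pol K m N).
Proof.
move=> DP c p q; rewrite !(zeta_qp K2 DP); under eq_bigr do rewrite pd_linear.
by rewrite big_split -scaler_sumr scalerDr scalerBr !scalerA [_ * c]mulrC opprD addrACA.
Qed.

Lemma theta_diag w a b t :
  Theta w (diag_act DN amu a b t) = zeta DD a b (Theta w t).
Proof.
have DNz := zeta_linear a b DN_sign.
have DDz := zeta_linear a b (dataNL_sign n_even l_even).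
have idl (V : lmodType K) : linear (id : V -> V) by [].
have map_lin (V V' W W' : lmodType K) (f : V -> V') (g : W -> W') :
    linear f -> linear g -> linear (tens_map f g).
  move=> fl gl; apply: tens_lift_linear; split=> z c x y; rewrite ?fl ?gl.
    exact: (tens_bilin V' W').1.
  exact: (tens_bilin V' W').2.
have Al := act_lin amuP (Fgen G a b).
move: t; apply: tensor_ind => [u p||s t IHs IHt].
- rewrite /diag_act !tens_map_tens // (linearD_of (theta_linear hom w)).
  rewrite !(theta_tens hom) hmuP.2 [RHS](zeta_split K2 DN_sign DL_sign).
  by [].
- rewrite /diag_act (linear0_of (map_lin _ _ _ _ _ _ Al (idl _))).
  rewrite (linear0_of (map_lin _ _ _ _ _ _ (idl _) DNz)) addr0.
  by rewrite (linear0_of (theta_linear hom w)) (linear0_of DDz).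
- rewrite [in RHS](linearD_of (theta_linear hom w)) (linearD_of DDz) -IHs -IHt.
  rewrite -(linearD_of (theta_linear hom w)) /diag_act.
  rewrite (linearD_of (map_lin _ _ _ _ _ _ Al (idl _))).
  by rewrite (linearD_of (map_lin _ _ _ _ _ _ (idl _) DNz)) addrACA.
Qed.

Lemma zeta_mx_mul c d p q :
  zeta_mx G n l m c d (mul_emb p q) = mul_emb (zeta DL c d p) q.
Proof.
rewrite (zeta_qp K2 DL_sign) mxE pdDE pdNE pdSE pd_sumE.
have -> (x y : Pol K m l) : mul_emb (x - y) q = mul_emb x q - mul_emb y q.
  by rewrite /mul_emb /emb_l rmorphB mulrBl.
rewrite mul_embZl mul_emb_suml; congr (_ - _); apply: eq_bigr => k _.
by rewrite pdME pop_r qop_r.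
Qed.

Lemma geom_mul w u q k c d :
  mul_emb (hmu (amu (resolvent G m k c d) u) w) q =
  geom (zeta_mx G n l m) k c d (mul_emb (hmu u w) q).
Proof.
have mul0 p : mul_emb (0 : Pol K m l) p = 0 by rewrite /mul_emb /emb_l rmorph0 mul0r.
case: k => [|k].
  by rewrite /= !mxE (act0 amuP) (linear0_of (hmu_linl hom w)) mul0 pd0E.
elim: k u c d => [|k IH] u c d /=.
  rewrite !mxE; case: (c == d) => /=.
    by rewrite (act1 amuP) scale1r.
  by rewrite (act0 amuP) (linear0_of (hmu_linl hom w)) mul0 scale0r.
rewrite !mxE (act_sum amuP) (linear_sum_of (hmu_linl hom w)) mul_emb_suml pd_sumE.
apply: eq_bigr => e _; rewrite pdME [in LHS]mxE (actM amuP) hmuP.2 -zeta_mx_mul.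
exact: (congr1 (zeta_mx G n l m c e) (IH u e d)).
Qed.

Lemma subst_mul e0 c0 (s : nat -> env (fm K G m)) (s' : nat -> PDnl) w u q k :
  (forall k, mul_emb (hmu (amu (s k) u) w) q = s' k (mul_emb (hmu u w) q)) ->
  mul_emb (hmu (amu (ser_subst e0 c0 s k) u) w) q =
  (ser_subst e0 c0 s' k : PDnl) (mul_emb (hmu u w) q).
Proof.
move=> ss'; rewrite /ser_subst (act_sum amuP) (linear_sum_of (hmu_linl hom w)).
rewrite mul_emb_suml pd_sumE; apply: eq_bigr => r _.
by rewrite (actM amuP) (act_scal amuP) (linearZ_of (hmu_linl hom w)) mul_embZl ss'.
Qed.

Variable gamma : XYangian DN -> env (lie_isometry DD).
Hypothesis gammaP : is_olshanski gamma.
Variable beta : XYangian DN -> tens_alg (env (fm K G m)) (PD K (m * n)).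
Hypothesis betaP : is_beta beta.
Variable act : tens_alg (env (fm K G m)) (PD K (m * n)) ->
  Lmu ⊗ Pol K m n -> Lmu ⊗ Pol K m n.
Hypothesis actP : is_tens_action amu (@pd_fun K (m * n)) act.
Variable tau : XYangian DN -> XYangian DN.
Hypothesis tauP : is_rescaling (f_series G l m) tau.

(** The first tensor factor sees only the last l columns of variables and the
    second only the first n, so F_cd(u) ⊗ p_ci q_dj becomes p_ci X_cd q_dj. *)
Lemma theta_beta w t k i j :
  Theta w (act (beta (Sgen DN k i j)) t) =
  (scal (ser_one k *+ (i == j)) +
   \sum_c \sum_d pop DD c (lshift l i) *
     ser_subst 1 (pm K G / 2%:R + m%:R) (fun r => geom (zeta_mx G n l m) r c d) k *
     qop DD d (lshift l j) : PDnl) (Theta w t).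
Proof.
have thl : linear (Theta w) := theta_linear hom w; have [aP aE] := actP.
rewrite betaP.2 (actD aP) (act_scal aP) (linearD_of thl) (linearZ_of thl) pdDE; congr (_ + _).
rewrite (act_sum aP) (linear_sum_of thl) pd_sumE; apply: eq_bigr => c _.
rewrite (act_sum aP) (linear_sum_of thl) pd_sumE; apply: eq_bigr => d _.
move: t; apply: tensor_ind => [u p||s t IHs IHt].
- rewrite aE !(theta_tens hom) [RHS]pdME [RHS]pdME [X in _ = pd_fun _ (pd_fun _ X)]qop_l.
  rewrite -(@subst_mul _ _ (fun r => resolvent G m r c d)) => [|r]; last exact: geom_mul.
  by rewrite pop_l.
- by rewrite (linear0_of (act_lin aP _)) (linear0_of thl) pd0.
- by rewrite (linearD_of (act_lin aP _)) !(linearD_of thl) IHs IHt -pdD.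
Qed.

Lemma gamma_morph : alg_morph gamma.
Proof.
have [om [io [om' [p [[omM _] [ioM _] [om'M _] [pM _] gammaE]]]]] := gammaP.
have M := alg_morph_comp omM (alg_morph_comp ioM (alg_morph_comp om'M pM)).
split=> [x y||c]; last by rewrite gammaE (alg_morph_scal M).
  by rewrite !gammaE (alg_morphD M).
by split=> [|x y]; rewrite !gammaE ?(alg_morph1 M) ?(alg_morphM M).
Qed.

(** It is enough to compare generators.  For gamma the coefficients of S(u) are
    those of f(u) (1 + Pn X Qn), by [gamma_seriesE]; for beta the same series comes
    from the rescaling and [theta_beta]. *)
Lemma theta_action x w t :
  Theta w (act (beta (tau x)) t) = env_dpol (gamma x) (Theta w t).
Proof.
have thl v : linear (Theta v) := theta_linear hom v; have [aP aE] := actP.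
have [bM _] := betaP; have [tM tE] := tauP; have gM := gamma_morph.
have ZM := @env_dpol_morph K m (n + l) DD.
move: x w t; apply: presented_ind => [c|[[r i] j]|a b IHa IHb|a b IHa IHb] w t.
- by rewrite (alg_morph_scal tM) (alg_morph_scal bM) (act_scal aP) (linearZ_of (thl w)) (alg_morph_scal gM) (alg_morph_scal ZM).
- have -> : pres_gen _ (r, i, j) = Sgen DN r.+1 i j by rewrite mxE.
  rewrite tE (alg_morph_sum bM) (act_sum aP) (linear_sum_of (thl w)).
  rewrite (gamma_seriesE m n_even l_even gammaP) pd_sumE; apply: eq_bigr => s _.
  by rewrite (alg_morphM bM) (alg_morph_scal bM) (actM aP) (act_scal aP) (linearZ_of (thl w)) theta_beta pdME.
- by rewrite (alg_morphD tM) (alg_morphD bM) (actD aP) (linearD_of (thl w)) IHa IHb (alg_morphD gM) (alg_morphD ZM).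
- by rewrite (alg_morphM tM) (alg_morphM bM) (actM aP) IHa IHb (alg_morphM gM) (alg_morphM ZM).
Qed.

(** * The two spaces of homomorphisms *)

Variables (Wlam : vectType K) (rlam : 'M[K]_(n + l) -> 'End(Wlam)).
Variable dlam : env (lie_isometry DD) -> Wlam -> Wlam.
Hypothesis dlamP : is_differential rlam dlam.
Variables (Llam : lmodType K) (alam : env (fm K G m) -> Llam -> Llam).
Variable hlam : Wlam -> Llam -> Pol K m (n + l).
Hypothesis hlamP : is_howe_lam rlam alam hlam.
Implicit Types (phi : Llam -> Lmu ⊗ Pol K m n) (psi : Wmu -> Wlam).

Lemma hlam_inj x y : (forall v, hlam x v = hlam y v) -> x = y.
Proof.
have [[hl h0 _ _] _] := hlamP => xy; apply/eqP; rewrite -subr_eq0; apply/eqP.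
by apply: h0 => v; rewrite (linearD_of (hl v)) (linearN_of (hl v)) xy subrr.
Qed.

(** For fixed w, composing phi with theta w intertwines f_m, hence is given by
    an element of Wlam. *)
Lemma source_to_target phi : source_hom alam amu phi ->
  exists! psi, target_hom G rlam rmu psi /\ corresponds hlam hmu phi psi.
Proof.
case=> phil phie; have [[hl _ _ hsurj] heq] := hlamP.
have /choice[psi psiE] w : exists x, hlam x =1 (fun v => Theta w (phi v)).
  apply: hsurj; split=> [c u v|a b v].
    by rewrite phil (theta_linear hom w).
  by rewrite phie theta_diag.
exists psi; split=> [|psi' [_ psi'E]]; last first.
  apply: funext => w; apply: hlam_inj => v; exact: (etrans (psiE w v) (esym (psi'E w v))).
split=> [|w v]; last exact: psiE.
have homr u := hmu_linr hom u.
have gl_theta h w t : in_isom_group DL h ->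
    Theta (rmu h w) t = pol_act (emb_gl n h) (Theta w t).
  move=> hG; move: t; apply: tensor_ind => [u p||s t IHs IHt].
  - rewrite !(theta_tens hom) pol_act_split; congr (mul_emb _ _).
    by case: hom => _ _ hh _; case: (hh u) => _; exact.
  - by rewrite !(linear0_of (theta_linear hom _)) /pol_act rmorph0.
  - by rewrite !(linearD_of (theta_linear hom _)) IHs IHt /pol_act rmorphD.
have lin_theta t : linear (Theta ^~ t).
  move: t; apply: tensor_ind => [u p c x y||s t IHs IHt c x y].
  - by rewrite !(theta_tens hom) homr (mul_emb_bilin n l m).1.
  - by move=> c x y; rewrite !(linear0_of (theta_linear hom _)) scaler0 addr0.
  - rewrite !(linearD_of (theta_linear hom _)) IHs IHt scalerDr.
    by rewrite addrACA.
split=> [c x y|h hG w]; apply: hlam_inj => v.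
  by rewrite psiE lin_theta hl !psiE.
by rewrite heq ?emb_gl_isom // !psiE gl_theta.
Qed.

(** For fixed v, the polynomials hlam (psi w) v form an equivariant family
    indexed by w, hence come from one tensor. *)
Lemma target_to_source psi : target_hom G rlam rmu psi ->
  exists! phi, source_hom alam amu phi /\ corresponds hlam hmu phi psi.
Proof.
case=> psil psie; have [[hl _ hh _] heq] := hlamP.
have /choice[phi phiE] v : exists t, forall w, Theta w t = hlam (psi w) v.
  apply: (theta_surj hom) => [c x y|h hG w]; first by rewrite psil hl.
  by rewrite psie // heq // emb_gl_isom.
exists phi; split=> [|phi' [_ phi'E]]; last first.
  apply: funext => v; apply: (theta_inj2 hom) => w; exact: (etrans (phiE v w) (phi'E w v)).
split=> [|w v]; last exact: (esym (phiE v w)).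
split=> [c x y|a b v]; apply: (theta_inj2 hom) => w; have [hlin hz] := hh (psi w).
  by rewrite phiE hlin (theta_linear hom w) !phiE.
by rewrite theta_diag !phiE hz.
Qed.

(** Only the correspondence needs [theta_action].  The new phi intertwines f_m
    because every hlam y does and the maps theta w separate tensors; the new psi is
    equivariant because it must be the partner of the new phi. *)
Lemma actions_correspond x phi psi :
  source_hom alam amu phi -> target_hom G rlam rmu psi ->
  corresponds hlam hmu phi psi ->
  [/\ source_hom alam amu (fun v => act (beta (tau x)) (phi v)),
      target_hom G rlam rmu (fun w => dlam (gamma x) (psi w))
    & corresponds hlam hmu (fun v => act (beta (tau x)) (phi v))
                           (fun w => dlam (gamma x) (psi w))].
Proof.
move=> phiP psiP cor; have [[hl _ hh _] heq] := hlamP.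
set phi' := fun v => _; set psi' := fun w => _.
have cor' w v : hlam (psi' w) v = Theta w (phi' v).
  rewrite theta_action -[Theta w (phi v)](cor w v).
  apply: (differential_pol_act dlamP (h := fun y => hlam y v)); first exact: hl.
  by move=> g gG y; rewrite heq.
have source' : source_hom alam amu phi'.
  split=> [c x' y|a b v]; apply: (theta_inj2 hom) => w; have [hlin hz] := hh (psi' w).
    by rewrite (theta_linear hom w) -!cor' hlin.
  by rewrite theta_diag -!cor' hz.
split=> //; have [psi2 [[t2 c2] _]] := source_to_target source'.
suff -> : psi' = psi2 by [].
apply: funext => w; apply: hlam_inj => v; exact: (etrans (cor' w v) (esym (c2 w v))).
Qed.
End Comparison.

Theorem theorem6p1 (R : realType) (G : gtype) (n l m : nat)
    (n_gt0 : (0 < n)%N) (l_gt0 : (0 < l)%N) (m_gt0 : (0 < m)%N)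
    (symp_even : G = Symp -> ~~ odd n /\ ~~ odd l)
    (* the partitions *)
    (lam mu : seq nat)
    (lamP : is_param G (n + l) lam) (muP : is_param G l mu)
    (lam_le_m : (conj_part lam 1 <= m)%N) (mu_le_m : (conj_part mu 1 <= m)%N)
    (* W_lambda, with the action of U(g_{n+l}), and W_mu *)
    (Wlam Wmu : vectType R[i])
    (rlam : 'M[R[i]]_(n + l) -> 'End(Wlam)) (rmu : 'M[R[i]]_l -> 'End(Wmu))
    (rlamP : is_irrep_with_parameter (dataNL R[i] G n l) rlam lam)
    (rmuP : is_irrep_with_parameter (dataL R[i] G l) rmu mu)
    (dlam : env (lie_isometry (dataNL R[i] G n l)) -> Wlam -> Wlam)
    (dlamP : is_differential rlam dlam)
    (* the simple f_m-modules of highest weights \bar\lambda and \bar\mu *)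
    (Llam Lmu : lmodType R[i])
    (alam : env (fm R[i] G m) -> Llam -> Llam) (amu : env (fm R[i] G m) -> Lmu -> Lmu)
    (alamP : is_simple_hw alam (weight_of (n + l) lam))
    (amuP : is_simple_hw amu (weight_of l mu))
    (* the identifications given by Howe duality *)
    (hlam : Wlam -> Llam -> {mpoly R[i][m * (n + l)]})
    (hmu : Lmu -> Wmu -> {mpoly R[i][m * l]})
    (hlamP : is_howe_lam rlam alam hlam) (hmuP : is_howe_mu rmu amu hmu)
    (* the Olshanski homomorphism *)
    (gamma : XYangian (dataN R[i] G n) -> env (lie_isometry (dataNL R[i] G n l)))
    (gammaP : is_olshanski gamma)
    (* the action of X(g_n) on F_m(L_mu) *)
    (beta : XYangian (dataN R[i] G n) -> tens_alg (env (fm R[i] G m)) (PD R[i] (m * n)))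
    (betaP : is_beta beta)
    (act : tens_alg (env (fm R[i] G m)) (PD R[i] (m * n)) ->
           Lmu ⊗ {mpoly R[i][m * n]} -> Lmu ⊗ {mpoly R[i][m * n]})
    (actP : is_tens_action amu (@pd_fun R[i] (m * n)) act)
    (* the automorphism S(u) |-> f(u) S(u) *)
    (tau : XYangian (dataN R[i] G n) -> XYangian (dataN R[i] G n))
    (tauP : is_rescaling (f_series G l m) tau) :
  (* Hom_{f_m}(L_lambda, L_mu (x) P) = Hom_{G_l}(W_mu, W_lambda) *)
  [/\ forall phi, source_hom alam amu phi ->
        exists! psi, target_hom G rlam rmu psi /\ corresponds hlam hmu phi psi,
      forall psi, target_hom G rlam rmu psi ->
        exists! phi, source_hom alam amu phi /\ corresponds hlam hmu phi psi
  (* the two actions of X(g_n) coincide under this identification *)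
    & forall x phi psi,
        source_hom alam amu phi -> target_hom G rlam rmu psi ->
        corresponds hlam hmu phi psi ->
        [/\ source_hom alam amu (fun v => act (beta (tau x)) (phi v)),
            target_hom G rlam rmu (fun w => dlam (gamma x) (psi w))
          & corresponds hlam hmu (fun v => act (beta (tau x)) (phi v))
                                 (fun w => dlam (gamma x) (psi w))]].
Proof.
have K2 : 2%:R != 0 :> R[i] by rewrite Num.Theory.pnatr_eq0.
have n_even GS : ~~ odd n := (symp_even GS).1.
have l_even GS : ~~ odd l := (symp_even GS).2.
have amuA : Defs.is_action amu by case: amuP => [[]].
split.
- exact: (source_to_target K2 n_even l_even amuA hmuP hlamP).
- exact: (target_to_source K2 n_even l_even amuA hmuP hlamP).
- exact: (actions_correspond K2 n_even l_even amuA hmuP gammaP betaP actP tauP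
            dlamP hlamP).
Qed.
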